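(* Let $\mathbb{F}_r$ ($r\ge2$) be the free group with free generators $a_1,\dots,a_r$, let $S=\{a_i^{\pm1}\}$, let $\sigma_k$ be the uniform probability measure on the sphere $\{w\in\mathbb{F}_r:|w|_S=k\}$ of the word metric, and let $\mu_n=\frac{1}{n+1}\sum_{k=0}^n\sigma_k$. Then for every measure-preserving action of $\mathbb{F}_r$ on a probability space $(X,m)$: (a) the weak-type $(1,1)$ maximal inequality $m\{x:\sup_n|\pi(\mu_n)f(x)|>\delta\}\le\frac{C}{\delta}\|f\|_{L^1(X)}$ holds for all $f\in L^1(X)$, $\delta>0$, with $C$ independent of the action; (b) for every $1\le p<\infty$ and $f\in L^p(X)$, $\pi(\mu_n)f$ converges almost everywhere and in $L^p$-norm to the conditional expectation of $f$ onto the $\mathbb{F}_r$-invariant $\sigma$-algebra (which is $\int_X f\,dm$ if the action is ergodic).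
   Context: $|w|_S$ is the word length of $w$ with respect to $S$; $\pi(\mu)f(x)=\sum_{w}\mu(w)f(w^{-1}x)$. *)

(* Defs.v *)
From HB Require Import structures.
From mathcomp Require Import all_boot all_order all_algebra.
From mathcomp Require Import all_classical all_reals all_analysis.
Set Implicit Arguments. Unset Strict Implicit. Unset Printing Implicit Defensive.
Import Order.TTheory GRing.Theory Num.Theory.
Local Open Scope classical_set_scope.
Local Open Scope ring_scope.

(* A letter (i, b) stands for a_i if b = false and a_i^{-1} if b = true. *)
Definition letter (r : nat) := ('I_r * bool)%type.
Definition linv (r : nat) (l : letter r) : letter r := (l.1, ~~ l.2).

Fixpoint reduced (r : nat) (s : seq (letter r)) : bool :=
  match s with
  | x :: ((y :: _) as t) => (y != linv x) && reduced t
  | _ => true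
  end.

Definition push (r : nat) (l : letter r) (s : seq (letter r)) : seq (letter r) :=
  match s with
  | y :: t => if y == linv l then t else l :: s
  | [::] => [:: l]
  end.

Definition reduce (r : nat) (s : seq (letter r)) : seq (letter r) :=
  foldr (@push r) [::] s.

Lemma reduced_cons_tail (r : nat) (x : letter r) s :
  reduced (x :: s) -> reduced s.
Proof. by case: s => //= y t /andP[]. Qed.

Lemma reduced_push (r : nat) (l : letter r) s : reduced s -> reduced (push l s).
Proof.
case: s => [|y t] //= Hs.
case: ifP => [_|/negbT Hy]; first exact: reduced_cons_tail Hs.
by rewrite /= Hy.
Qed.

Lemma reduce_reduced (r : nat) (s : seq (letter r)) : reduced (reduce s).
Proof. by elim: s => [|l s IH] //=; exact: reduced_push. Qed.

Definition FG (r : nat) := {s : seq (letter r) | reduced s}.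

Definition fg_one (r : nat) : FG r := exist _ [::] isT.
Definition fg_mul (r : nat) (u v : FG r) : FG r :=
  exist _ (reduce (sval u ++ sval v)) (reduce_reduced _).
Definition fg_inv (r : nat) (u : FG r) : FG r :=
  exist _ (reduce (rev (map (@linv r) (sval u)))) (reduce_reduced _).

Definition wlen (r : nat) (w : FG r) : nat := size (sval w).

(* the sphere {w : |w|_S = k}, as a duplicate-free list *)
Definition sphere (r k : nat) : seq (FG r) :=
  pmap (fun s : seq (letter r) => insub s)
       [seq tval t | t in {: k.-tuple (letter r)}].

Definition mp_action (r : nat) (R : realType) (d : measure_display)
    (X : measurableType d) (m : probability X R) (act : FG r -> X -> X) : Prop :=
  [/\ (forall x, act (fg_one r) x = x),
      (forall u v x, act (fg_mul u v) x = act u (act v x)),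
      (forall w, measurable_fun setT (act w)) &
      (forall w (A : set X), measurable A -> m (act w @^-1` A) = m A)].

Definition pi_sigma (r : nat) (R : realType) (X : Type) (act : FG r -> X -> X)
    (k : nat) (f : X -> R) (x : X) : R :=
  (size (sphere r k))%:R^-1 * \sum_(w <- sphere r k) f (act (fg_inv w) x).

Definition pi_mu (r : nat) (R : realType) (X : Type) (act : FG r -> X -> X)
    (n : nat) (f : X -> R) (x : X) : R :=
  (n.+1)%:R^-1 * \sum_(k < n.+1) pi_sigma act k f x.

Definition invariant_set (r : nat) (d : measure_display) (X : measurableType d)
    (act : FG r -> X -> X) (A : set X) : Prop :=
  measurable A /\ forall w, act w @^-1` A = A.

Definition cond_exp_inv (r : nat) (R : realType) (d : measure_display)
    (X : measurableType d) (m : probability X R) (act : FG r -> X -> X)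
    (f g : X -> R) : Prop :=
  [/\ (forall B : set R, measurable B -> invariant_set act (g @^-1` B)),
      m.-integrable setT (EFin \o g) &
      (forall A, invariant_set act A ->
         (\int[m]_(x in A) (g x)%:E = \int[m]_(x in A) (f x)%:E)%E)].

(* Main.v *)
Require Import Defs.
From HB Require Import structures.
From mathcomp Require Import all_boot all_order all_algebra.
From mathcomp Require Import all_classical all_reals all_analysis.
From mathcomp Require Import measurable_realfun.
From mathcomp Require Import ring lra zify.
Import Order.TTheory GRing.Theory Num.Theory numFieldNormedType.Exports.
Local Open Scope classical_set_scope.
Local Open Scope ring_scope.

(* Write [A = pi(sigma_1)] and [q = 2r - 1].  Counting reduced words gives
   [(q + 1) A sigma_(k+1) = q sigma_(k+2) + sigma_k], and two facts about the
   [mu_n] follow from this recursion alone.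
   - The spheres up to radius [n] are dominated by the Green function of the
     radial random walk up to time [6(n + 1)], because the walk drifts outwards:
     for [f >= 0], [(n + 1) mu_n f <= 2 \sum_(k < 6(n+1)) A^k f].  Hopf's maximal
     inequality for the Markov operator [A] then gives the weak type bound.
   - [(1 - A) \sum_(k <= n) sigma_k] telescopes, so [mu_n] applied to a bounded
     coboundary [phi - A phi] is uniformly [O(1/n)].
   If [h] is bounded with zero integral on invariant sets, [u = limsup] of the
   Cesaro means of [A^k h] satisfies [u <= A u], hence [A u = u] and then [u] is
   invariant; applying Hopf's inequality on the invariant set [u > e] shows that
   these means tend to 0.  So [h] is approximated in [L^1] by coboundaries
   of bounded functions, and the maximal inequality yields almost everywhere
   convergence of [mu_n f] for all [f] in [L^1].
   Convergence in [L^p] follows from [|mu_n f|^p <= mu_n |f|^p], whose right-hand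
   side converges almost everywhere with constant integrals. *)

Set Implicit Arguments. Unset Strict Implicit. Unset Printing Implicit Defensive.

(** * Reduced words and the recursion for sphere averages *)

Lemma linvK r : involutive (@linv r).
Proof. by case=> i b; rewrite /linv /= negbK. Qed.

Lemma reduced_consE r (l : letter r) s :
  reduced (l :: s) = (ohead s != Some (linv l)) && reduced s.
Proof. by case: s. Qed.

Lemma reduce_id r (s : seq (letter r)) : reduced s -> reduce s = s.
Proof.
elim: s => [//|l s IH] rs; have := reduced_cons_tail rs => /IH /= ->.
by case: s rs {IH} => [//|y t] /= /andP[/negbTE ->].
Qed.

Lemma sum_tuple_cons (V : nmodType) (A : finType) n (F : seq A -> V) :
  \sum_(t : n.+1.-tuple A) F t = \sum_a \sum_(t : n.-tuple A) F (a :: t).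
Proof.
rewrite pair_big /= (reindex (fun p : A * n.-tuple A => cons_tuple p.1 p.2)) //=.
exists (fun t : n.+1.-tuple A => (thead t, behead_tuple t)).
  by move=> [a t] _ /=; congr pair; apply: val_inj.
by move=> t _; rewrite [RHS]tuple_eta; apply: val_inj.
Qed.

Section Words.
Variables (r : nat) (X : Type) (act : FG r -> X -> X).
Hypothesis act1 : forall x, act (fg_one r) x = x.
Hypothesis actM : forall u v x, act (fg_mul u v) x = act u (act v x).

Definition word (s : seq (letter r)) : FG r := exist _ (reduce s) (reduce_reduced s).

Definition gen (l : letter r) : X -> X := act (word [:: l]).

Lemma word_sval (w : FG r) : word (sval w) = w.
Proof. by case: w => s rs; apply: val_inj => /=; exact: reduce_id. Qed.

Lemma genK l x : gen (linv l) (gen l x) = x.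
Proof.
rewrite /gen -actM -[RHS]act1; congr (act _ _); apply: val_inj => /=.
by rewrite linvK eqxx.
Qed.

Lemma act_word s x : act (word s) x = foldr gen x s.
Proof.
elim: s => [|l s IH] /=.
  by rewrite -[RHS]act1; congr (act _ _); apply: val_inj.
rewrite -IH /gen -actM; congr (act _ _); apply: val_inj => /=.
by rewrite (reduce_id (reduce_reduced s)).
Qed.

(** The inverse of a word applies the inverse letters from left to right. In this form, prefixing a
    letter to the word only moves the base point. *)
Definition walk (s : seq (letter r)) (x : X) : X :=
  foldl (fun y l => gen (linv l) y) x s.

Lemma act_inv (w : FG r) x : act (fg_inv w) x = walk (sval w) x.
Proof.
rewrite -[fg_inv w]/(word (rev (map (@linv r) (sval w)))) act_word.
rewrite -[foldr _ _ _](@foldl_rev _ _ (fun y l => gen l y)) revK.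
by elim: (sval w) x => //= l s IH x; rewrite -IH.
Qed.

Variable R : realType.
Implicit Type f : X -> R.

(** The unnormalised sphere sum, taken over all tuples with the non-reduced ones weighted by 0, so
    that letters can be split off freely. [rsum k (fun=> 1)] is the size of the sphere. *)
Definition rsum k f x : R :=
  \sum_(t : k.-tuple (letter r)) f (walk t x) *+ reduced t.

Lemma sum_sphere k (F : seq (letter r) -> R) :
  \sum_(w <- sphere r k) F (sval w) = \sum_(t : k.-tuple (letter r)) F t *+ reduced t.
Proof.
have aux (s : seq (seq (letter r))) :
    \sum_(w <- pmap (fun s => insub s : option (FG r)) s) F (sval w) =
    \sum_(t <- s) F t *+ reduced t.
  elim: s => [|t s IH] /=; first by rewrite !big_nil.
  rewrite [RHS]big_cons -IH; case: insubP => [u -> <-|/negbTE ->] /=.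
    by rewrite big_cons.
  by rewrite add0r.
by rewrite /sphere aux big_map big_enum.
Qed.

Lemma pi_sigma_rsum k f x :
  pi_sigma act k f x = (rsum k (fun=> 1) x)^-1 * rsum k f x.
Proof.
rewrite /pi_sigma; under eq_bigr do rewrite act_inv.
rewrite (sum_sphere _ (fun s => f (walk s x))); congr (_^-1 * _).
by rewrite -[RHS](@sum_sphere _ (fun=> 1)) big_const_seq count_predT iter_addr addr0.
Qed.

Lemma rsum0 f x : rsum 0 f x = f x.
Proof.
rewrite /rsum (eq_bigr (fun=> f x)); last by move=> t _; rewrite tuple0.
by rewrite sumr_const card_tuple expn0.
Qed.

Lemma rsumS k f x :
  rsum k.+1 f x = \sum_l \sum_(t : k.-tuple (letter r))
     f (walk t (gen (linv l) x)) *+ reduced (l :: t).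
Proof.
exact: (@sum_tuple_cons _ _ _ (fun s => f (walk s x) *+ reduced s)).
Qed.

Lemma rsum1 f x : rsum 1 f x = \sum_l f (gen l x).
Proof.
rewrite rsumS (reindex_inj (inv_inj (@linvK r))) /=; apply: eq_bigr => l _.
rewrite (eq_bigr (fun=> f (gen l x))); last first.
  by move=> t _; rewrite tuple0 linvK.
by rewrite sumr_const card_tuple expn0.
Qed.

(* [rsum k (f o T)] summed over the letters runs over all words [l :: t] with
   [t] reduced; the word is either reduced or starts with [l, linv l]. *)
Lemma sum_rsum_gen k f x :
  \sum_l rsum k.+1 f (gen l x) = rsum k.+2 f x +
    (if k is 0 then (2 * r)%N else (2 * r).-1)%:R * rsum k f x.
Proof.
rewrite (reindex_inj (inv_inj (@linvK r))) /= rsumS.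
have E l : rsum k.+1 f (gen (linv l) x) =
    \sum_(t : k.+1.-tuple (letter r)) f (walk t (gen (linv l) x)) *+ reduced (l :: t) +
    \sum_(t : k.-tuple (letter r)) f (walk t x) *+ reduced (linv l :: t).
  rewrite /rsum.
  rewrite (eq_bigr (fun t : k.+1.-tuple _ => f (walk t (gen (linv l) x)) *+ reduced (l :: t) +
     f (walk t (gen (linv l) x)) *+ ((ohead t == Some (linv l)) && reduced t))).
    rewrite big_split /=; congr (_ + _).
    rewrite (@sum_tuple_cons _ _ _ (fun s => f (walk s (gen (linv l) x)) *+
      ((ohead s == Some (linv l)) && reduced s))) (bigD1 (linv l)) //=.
    rewrite [X in _ + X]big1 ?addr0 => [|a /negbTE al].
      apply: eq_bigr => t _; rewrite eqxx /=; congr (f (walk _ _) *+ _).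
      exact: genK.
    by apply: big1 => t _; rewrite (inj_eq Some_inj) al mulr0n.
  move=> t _; rewrite reduced_consE; case: eqP => _ /=; first by rewrite add0r.
  by rewrite mulr0n addr0.
under eq_bigr do rewrite E.
rewrite big_split /=; congr (_ + _).
(* It remains to count the letters [l] that keep [linv l :: t] reduced: all [2 * r] of them if [t]
   is empty, all but the head of [t] otherwise. *)
rewrite exchange_big /= mulr_sumr; apply: eq_bigr => t _.
rewrite mulr_natl -mulrnA sumrMnr mulnC; congr (_ *+ _).
case: k {E} t => [|k] t.
  rewrite tuple0 muln1 (eq_bigr (fun=> 1%N)) => [|l _ //].
  by rewrite sum1_card card_prod card_ord card_bool mulnC.
case/tupleP: t => a t; rewrite (bigD1 a) //= linvK eqxx add0n.
case: (match _ with [::] => _ | _ :: _ => _ end); last by rewrite big1 ?muln0 // => l _; rewrite andbF.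
rewrite muln1 (eq_bigr (fun=> 1%N)) => [|l la]; last first.
  by rewrite andbT linvK eq_sym la.
rewrite sum1_card; have := cardC1 a.
rewrite card_prod card_ord card_bool mulnC => <-; apply: eq_card => l.
by rewrite !inE.
Qed.

Lemma rsum_count x k :
  rsum k.+1 (fun=> 1) x =
  (if k is 0 then (2 * r)%N else (2 * r).-1)%:R * rsum k (fun=> 1) x.
Proof.
have cst k' y : rsum k' (fun=> 1) y = rsum k' (fun=> 1) x by [].
elim: k => [|k IH].
  by rewrite rsum1 rsum0 mulr1 sumr_const card_prod card_ord card_bool mulnC.
have := sum_rsum_gen k (fun=> 1) x.
rewrite (eq_bigr (fun=> rsum k.+1 (fun=> 1) x)) // sumr_const -IH => E.
apply: (addIr (rsum k.+1 (fun=> 1) x)); rewrite -E.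
rewrite card_prod card_ord card_bool mulnC mulr_natl.
(* For [r = 0] the predecessor truncates, but then there are no letters and both sides vanish. *)
have [r0|r0] := posnP r; last first.
  have -> : (2 * r)%N = (2 * r).-1.+1 by lia.
  by rewrite /= mulrSr.
suff -> : rsum k.+1 (fun=> 1) x = 0 by rewrite !mul0rn addr0.
rewrite /rsum big1// => t _; case/tupleP: t => -[[i]]; by rewrite r0.
Qed.

Hypothesis r_gt0 : (0 < r)%N.

Lemma rsum_count_gt0 x k : 0 < rsum k (fun=> 1) x.
Proof.
elim: k => [|k IH]; first by rewrite rsum0.
by rewrite rsum_count mulr_gt0//; case: k {IH}; rewrite ltr0n; lia.
Qed.

Lemma pi_sigma0 f x : pi_sigma act 0 f x = f x.
Proof. by rewrite pi_sigma_rsum !rsum0 invr1 mul1r. Qed.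

Lemma pi_sigma1 f x :
  pi_sigma act 1 f x = #|{: letter r}|%:R^-1 * \sum_l f (gen l x).
Proof. by rewrite pi_sigma_rsum !rsum1 sumr_const. Qed.

(** The coefficient of the backtracking term in [sum_rsum_gen] is the ratio of consecutive sphere
    sizes, so after normalisation the case [k = 0] no longer differs from the others. *)
Lemma pi_sigma_rec f x k :
  (2 * r)%:R * pi_sigma act 1 (pi_sigma act k.+1 f) x =
  (2 * r).-1%:R * pi_sigma act k.+2 f x + pi_sigma act k f x.
Proof.
rewrite pi_sigma1 card_prod card_ord card_bool (mulnC r 2) mulVKf; last first.
  by rewrite pnatr_eq0; lia.
under eq_bigr do rewrite pi_sigma_rsum.
rewrite (eq_bigr (fun l => (rsum k.+1 (fun=> 1) x)^-1 * rsum k.+1 f (gen l x)))//.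
rewrite -mulr_sumr sum_rsum_gen mulrDr !pi_sigma_rsum.
have := rsum_count_gt0 x k; have := rsum_count_gt0 x k.+1.
have := rsum_count x k; have /= := rsum_count x k.+1.
move=> -> E p1 p0; congr (_ + _).
  rewrite invfM -mulrA mulVKf//.
  by rewrite pnatr_eq0; lia.
rewrite E invfM mulrACA mulVf ?mul1r//.
by move: p1; rewrite E => /lt0r_neq0; rewrite mulf_eq0 negb_or => /andP[].
Qed.
End Words.

(** * Markov operators *)

Section L1.
Variables (R : realType) (d : measure_display) (X : measurableType d).
Variable m : probability X R.
Implicit Types (f g h : X -> R) (A B : set X).

Definition L1 f := m.-integrable setT (EFin \o f).

Lemma L1_measurable f : L1 f -> measurable_fun setT f.
Proof. by move=> /measurable_int /measurable_EFinP. Qed.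

Lemma L1D f g : L1 f -> L1 g -> L1 (fun x => f x + g x).
Proof. by move=> Lf Lg; apply: eq_integrable (integrableD _ Lf Lg). Qed.

Lemma L1Z a f : L1 f -> L1 (fun x => a * f x).
Proof. by move=> Lf; apply: eq_integrable (integrableZl _ a Lf). Qed.

Lemma L1N f : L1 f -> L1 (fun x => - f x).
Proof. by move=> Lf; apply: eq_integrable (integrableN Lf). Qed.

Lemma L1B f g : L1 f -> L1 g -> L1 (fun x => f x - g x).
Proof. by move=> Lf Lg; apply: L1D => //; exact: L1N. Qed.

Lemma L1cst a : L1 (fun=> a).
Proof. exact: (finite_measure_integrable_cst m a measurableT). Qed.

Lemma L1_abs f : L1 f -> L1 (fun x => `|f x|).
Proof. exact: integrable_norm. Qed.

Lemma L1_le f g : measurable_fun setT f -> (forall x, `|f x| <= g x) -> L1 g -> L1 f.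
Proof.
move=> mf fg Lg; apply: le_integrable Lg => //; first exact/measurable_EFinP.
by move=> x _ /=; rewrite lee_fin (le_trans (fg x))// ler_norm.
Qed.

Lemma L1_bounded f K : measurable_fun setT f -> (forall x, `|f x| <= K) -> L1 f.
Proof. by move=> mf fK; apply: (L1_le mf fK); exact: L1cst. Qed.

Lemma L1_sum (I : Type) (s : seq I) (F : I -> X -> R) :
  (forall i, L1 (F i)) -> L1 (fun x => \sum_(i <- s) F i x).
Proof.
move=> LF; elim: s => [|i s IH].
  by apply: eq_integrable (L1cst 0) => // x _ /=; rewrite big_nil.
by apply: eq_integrable (L1D (LF i) IH) => // x _ /=; rewrite big_cons.
Qed.

Lemma L1_indic f B : measurable B -> L1 f -> L1 (fun x => f x * \1_B x).
Proof.
move=> mB Lf; apply: (L1_le _ _ (L1_abs Lf)).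
  by apply: measurable_funM => //; exact: L1_measurable.
by move=> x; rewrite normrM indicE ler_piMr// normr_nat; case: (_ \in _).
Qed.

Lemma L1_on f B : measurable B -> L1 f -> m.-integrable B (EFin \o f).
Proof. by move=> mB; apply: integrableS. Qed.

Lemma EFin_int f B : measurable B -> L1 f ->
  (\int[m]_(x in B) f x)%:E = (\int[m]_(x in B) (f x)%:E)%E.
Proof.
by move=> mB Lf; rewrite /Rintegral fineK// integrable_fin_num//; exact: L1_on.
Qed.

Lemma intD f g B : measurable B -> L1 f -> L1 g ->
  \int[m]_(x in B) (f x + g x) = \int[m]_(x in B) f x + \int[m]_(x in B) g x.
Proof. by move=> mB Lf Lg; rewrite RintegralD//; exact: L1_on. Qed.

Lemma intB f g B : measurable B -> L1 f -> L1 g ->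
  \int[m]_(x in B) (f x - g x) = \int[m]_(x in B) f x - \int[m]_(x in B) g x.
Proof. by move=> mB Lf Lg; rewrite RintegralB//; exact: L1_on. Qed.

Lemma intZ a f B : measurable B -> L1 f ->
  \int[m]_(x in B) (a * f x) = a * \int[m]_(x in B) f x.
Proof. by move=> mB Lf; rewrite RintegralZl//; exact: L1_on. Qed.

Lemma int_sum (I : Type) (s : seq I) (F : I -> X -> R) B : measurable B ->
  (forall i, L1 (F i)) ->
  \int[m]_(x in B) (\sum_(i <- s) F i x) = \sum_(i <- s) \int[m]_(x in B) F i x.
Proof.
move=> mB LF; elim: s => [|i s IH].
  rewrite big_nil; under eq_Rintegral do rewrite big_nil.
  by rewrite Rintegral_cst// mul0r.
rewrite big_cons -IH -intD//; last exact: L1_sum.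
by under eq_Rintegral do rewrite big_cons.
Qed.

Lemma int_le f g B : measurable B -> L1 f -> L1 g -> (forall x, B x -> f x <= g x) ->
  \int[m]_(x in B) f x <= \int[m]_(x in B) g x.
Proof. by move=> mB Lf Lg fg; apply: le_Rintegral => //; exact: L1_on. Qed.

Lemma int_indic f B : \int[m]_(x in B) f x = \int[m]_x (f x * \1_B x).
Proof.
rewrite Rintegral_mkcond; apply: eq_Rintegral => x _.
by rewrite /patch indicE; case: (_ \in _); rewrite ?mulr1 ?mulr0.
Qed.

Lemma int_cst a B : measurable B -> \int[m]_(x in B) a = a * fine (m B).
Proof. by move=> mB; rewrite Rintegral_cst. Qed.

Lemma int_ae0 f : L1 f -> (forall x, 0 <= f x) -> \int[m]_x f x = 0 ->
  {ae m, forall x, f x = 0}.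
Proof.
move=> Lf f0 I0.
have : (\int[m]_x `|(f x)%:E|)%E = 0%E.
  rewrite -[RHS]/(0%:E) -I0 (EFin_int measurableT Lf).
  by apply: eq_integral => x _; rewrite gee0_abs// lee_fin.
move=> /(ae_eq_integral_abs m measurableT) H.
have : ae_eq m setT (EFin \o f) (cst 0%E).
  by apply: H; apply/measurable_EFinP; exact: L1_measurable.
by apply: filterS => x /(_ I) [].
Qed.

Lemma int_ae_eq f g B : measurable B -> L1 f -> L1 g ->
  {ae m, forall x, f x = g x} -> \int[m]_(x in B) f x = \int[m]_(x in B) g x.
Proof.
move=> mB Lf Lg fg; congr fine; apply: ae_eq_integral => //.
- by apply: measurable_funTS; apply/measurable_EFinP/L1_measurable.
- by apply: measurable_funTS; apply/measurable_EFinP/L1_measurable.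
- by apply: filterS fg => x fg _; rewrite fg.
Qed.

Lemma int_eq0_negligible f : L1 f -> (forall x, 0 <= f x) -> \int[m]_x f x <= 0 ->
  {ae m, forall x, f x = 0}.
Proof.
by move=> Lf f0 I0; apply: int_ae0 => //; apply/eqP; rewrite eq_le I0 Rintegral_ge0.
Qed.
End L1.

(** * Positive unital operators that respect invariant sets *)

Section Markov.
Variables (R : realType) (d : measure_display) (X : measurableType d).
Variable m : probability X R.
Variable inv : set X -> Prop.
Hypothesis inv_measurable : forall B, inv B -> measurable B.
Hypothesis invT : inv setT.
Implicit Types (f g h : X -> R) (A : (X -> R) -> X -> R).

(** The operators act on functions, not on classes, so algebraic identities hold at every point.
    [mk_local] and [mk_int] express that distinct invariant sets do not interact. *)
Record markov_op A : Prop := MarkovOp {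
  mk_lin : forall a f g x, A (fun y => a * f y + g y) x = a * A f x + A g x;
  mk_ge0 : forall f, (forall x, 0 <= f x) -> forall x, 0 <= A f x;
  mk_one : forall x, A (fun=> 1) x = 1;
  mk_local : forall B f g, inv B -> (forall x, B x -> f x = g x) ->
    forall x, B x -> A f x = A g x;
  mk_measurable : forall f, measurable_fun setT f -> measurable_fun setT (A f);
  mk_L1 : forall f, L1 m f -> L1 m (A f);
  mk_int : forall B f, inv B -> L1 m f ->
    \int[m]_(x in B) A f x = \int[m]_(x in B) f x }.

Lemma eq_mk A f g : markov_op A -> f =1 g -> A f =1 A g.
Proof. by move=> mA fg x; rewrite (funext fg). Qed.

(** Change of variables: the pushforward of [m] under [tau] agrees with [m] on measurable sets, and
    an invariant set is its own preimage. *)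
Lemma markov_comp (tau : X -> X) : measurable_fun setT tau ->
  (forall B, measurable B -> m (tau @^-1` B) = m B) ->
  (forall B, inv B -> tau @^-1` B = B) -> markov_op (fun f x => f (tau x)).
Proof.
move=> mtau mp itau.
have mpf f : L1 m f -> L1 m (f \o tau) /\ forall B, inv B ->
    \int[m]_(x in B) f (tau x) = \int[m]_(x in B) f x.
  move=> Lf; have mf := L1_measurable Lf.
  have pE D (g : X -> \bar R) : measurable D ->
      (\int[pushforward m tau]_(x in D) g x = \int[m]_(x in D) g x)%E.
    by move=> mD; apply: eq_measure_integral => C mC _; exact: mp.
  have Lft : L1 m (f \o tau).
    apply/integrableP; split; first by apply/measurable_EFinP/measurableT_comp.
    have /integrableP[_] := Lf; rewrite -pE// ge0_integral_pushforward//.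
    by do 2 apply: measurableT_comp => //.
  split=> // B iB; congr fine.
  have mB := inv_measurable iB.
  rewrite -[RHS](pE _ (EFin \o f))// integral_pushforward ?itau//.
    exact/measurable_EFinP.
  exact: L1_on.
split=> //.
- by move=> B f g iB fg x Bx; apply: fg; rewrite -[B _]/((tau @^-1` B) x) itau.
- by move=> f mf; apply: measurableT_comp.
- by move=> f /mpf[].
- by move=> B f iB /mpf[_]; exact.
Qed.

Lemma markov_mean (I : Type) (s : seq I) (A : I -> (X -> R) -> X -> R) :
  (0 < size s)%N -> (forall i, markov_op (A i)) ->
  markov_op (fun f x => (size s)%:R^-1 * \sum_(i <- s) A i f x).
Proof.
move=> s0 mA; have sN0 : (size s)%:R != 0 :> R by rewrite pnatr_eq0 -lt0n.
split.
- move=> a f g x; rewrite mulrCA -mulrDr; congr (_ * _).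
  by rewrite mulr_sumr -big_split; apply: eq_bigr => i _ /=; rewrite (mk_lin (mA i)).
- move=> f f0 x; rewrite mulr_ge0// sumr_ge0// => i _.
  exact: (mk_ge0 (mA i)).
- move=> x; under eq_bigr do rewrite (mk_one (mA _)).
  by rewrite big_const_seq count_predT iter_addr addr0 mulVf.
- move=> B f g iB fg x Bx; congr (_ * _); apply: eq_bigr => i _.
  exact: (mk_local (mA i) iB fg Bx).
- move=> f mf; apply: measurable_funM => //; apply: measurable_sum => i.
  exact: (mk_measurable (mA i)).
- by move=> f Lf; apply: L1Z; apply: L1_sum => i; exact: (mk_L1 (mA i)).
- move=> B f iB Lf; have mB := inv_measurable iB.
  have LA i := mk_L1 (mA i) Lf.
  rewrite intZ//; last exact: L1_sum.
  rewrite int_sum// (eq_bigr (fun=> \int[m]_(x in B) f x)); last first.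
    by move=> i _; exact: (mk_int (mA i)).
  by rewrite big_const_seq count_predT iter_addr addr0 -[X in _ * X]mulr_natl mulKf.
Qed.

Section theory.
Variables (A : (X -> R) -> X -> R) (mA : markov_op A).

Lemma mk0 x : A (fun=> 0) x = 0.
Proof.
have := mk_lin mA (-1) (fun=> 0) (fun=> 0) x.
by rewrite (eq_mk (g := fun=> 0) mA) => [->|y]; ring.
Qed.

Lemma mkZ a f x : A (fun y => a * f y) x = a * A f x.
Proof.
rewrite -[RHS]addr0 -(mk0 x) -mk_lin//; apply: eq_mk => // y; ring.
Qed.

Lemma mkD f g x : A (fun y => f y + g y) x = A f x + A g x.
Proof.
rewrite -[A f x]mul1r -mk_lin//; apply: eq_mk => // y; ring.
Qed.

Lemma mkB f g x : A (fun y => f y - g y) x = A f x - A g x.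
Proof.
by rewrite mkD -mulN1r -mkZ; congr (_ + _); apply: eq_mk => // y; rewrite mulN1r.
Qed.

Lemma mk_cst a x : A (fun=> a) x = a.
Proof.
by rewrite -[RHS]mulr1 -(mk_one mA x) -mkZ; apply: eq_mk => // y; rewrite mulr1.
Qed.

Lemma mk_sum (I : Type) (s : seq I) (F : I -> X -> R) x :
  A (fun y => \sum_(i <- s) F i y) x = \sum_(i <- s) A (F i) x.
Proof.
elim: s => [|i s IH].
  by rewrite big_nil -[RHS](mk0 x); apply: eq_mk => // y; rewrite big_nil.
by rewrite big_cons -IH -mkD; apply: eq_mk => // y; rewrite big_cons.
Qed.

Lemma mk_le f g : (forall x, f x <= g x) -> forall x, A f x <= A g x.
Proof.
by move=> fg x; rewrite -subr_ge0 -mkB (mk_ge0 mA)// => y; rewrite subr_ge0.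
Qed.

Lemma mk_abs f x : `|A f x| <= A (fun y => `|f y|) x.
Proof.
rewrite ler_norml -mulN1r -mkZ; apply/andP; split; apply: mk_le => y.
  by rewrite mulN1r lerNl -normrN ler_norm.
exact: ler_norm.
Qed.

Lemma mk_bound f K : (forall x, `|f x| <= K) -> forall x, `|A f x| <= K.
Proof.
by move=> fK x; rewrite (le_trans (mk_abs f x))// -[leRHS](mk_cst K x) mk_le.
Qed.
End theory.
End Markov.

(** * Hopf's maximal inequality *)

Section Hopf.
Variables (R : realType) (d : measure_display) (X : measurableType d).
Variable m : probability X R.
Variable inv : set X -> Prop.
Hypothesis inv_measurable : forall B, inv B -> measurable B.
Hypothesis invT : inv setT.
Variables (A : (X -> R) -> X -> R) (mA : markov_op m inv A).
Implicit Types (f g h : X -> R).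

(** The sum of [A^k h] over [k < n] in Horner form, parallel to [omax]. *)
Fixpoint osum h n : X -> R :=
  if n is n'.+1 then fun x => h x + A (osum h n') x else fun=> 0.

(** Not the maximum of the partial sums but a majorant of it, the value of optimally stopping the
    sum. Its recursion makes the maximal inequality a pointwise matter. *)
Fixpoint omax h n : X -> R :=
  if n is n'.+1 then fun x => Num.max 0 (h x + A (omax h n') x) else fun=> 0.

Lemma L1_max0 f : L1 m f -> L1 m (fun x => Num.max 0 (f x)).
Proof.
move=> Lf; apply: (L1_le _ _ (L1_abs Lf)).
  by apply: measurable_maxr => //; exact: L1_measurable Lf.
by move=> x; case: (lerP 0 (f x)) => f0; rewrite ?normr0.
Qed.

Lemma osum_L1 h n : L1 m h -> L1 m (osum h n).
Proof.
move=> Lh; elim: n => [|n IH] /=; first exact: L1cst.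
by apply: L1D => //; exact: (mk_L1 mA IH).
Qed.

Lemma omax_L1 h n : L1 m h -> L1 m (omax h n).
Proof.
move=> Lh; elim: n => [|n IH] /=; first exact: L1cst.
by apply: L1_max0; apply: L1D => //; exact: (mk_L1 mA IH).
Qed.

Lemma osum_measurable h n : measurable_fun setT h -> measurable_fun setT (osum h n).
Proof.
move=> Lh; elim: n => [|n IH] //=; apply: measurable_funD => //.
exact: (mk_measurable mA).
Qed.

Lemma omax_ge0 h n x : 0 <= omax h n x.
Proof. by case: n => //= n; rewrite le_max lexx. Qed.

Lemma omaxS h n x : omax h n x <= omax h n.+1 x.
Proof.
elim: n x => [|n IH] x /=; first by rewrite le_max lexx.
rewrite ge_max !le_max lexx /=; apply/orP; right.
by rewrite lerD2l; apply: (mk_le mA).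
Qed.

Lemma omax_nd h k n x : (k <= n)%N -> omax h k x <= omax h n x.
Proof.
by move=> /subnK <-; elim: (n - k)%N => // j IH; rewrite addSn (le_trans IH)// omaxS.
Qed.

Lemma osum_le_omax h n x : osum h n x <= omax h n x.
Proof.
elim: n x => [|n IH] x //=; rewrite le_max; apply/orP; right.
by rewrite lerD2l; apply: (mk_le mA).
Qed.

Let pos h n := [set x | 0 < omax h n x].

Lemma pos_measurable h n : L1 m h -> measurable (pos h n).
Proof.
move=> Lh; have -> : pos h n = omax h n @^-1` `]0, +oo[%classic.
  by apply/seteqP; split=> x /=; rewrite /pos in_itv /= andbT.
by rewrite -[_ @^-1` _]setTI; exact: (L1_measurable (omax_L1 n Lh)).
Qed.

(* Garsia: on [0 < omax h n], [omax h n <= h + A (omax h n)]; elsewhere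
   [omax h n] vanishes. *)
Lemma garsia h n x : omax h n x - A (omax h n) x <= h x * \1_(pos h n) x.
Proof.
have A0 : 0 <= A (omax h n) x by apply: (mk_ge0 mA) => y; exact: omax_ge0.
rewrite indicE; have [/[1!inE] p|/negP p] := boolP (x \in pos h n); last first.
  have -> : omax h n x = 0.
    apply/eqP; rewrite eq_le omax_ge0 andbT leNgt; apply/negP => q.
    by apply: p; rewrite inE.
  by rewrite mulr0 sub0r oppr_le0.
case: n p A0 => [|n] p A0; first by rewrite /pos /= ltxx in p.
rewrite mulr1 lerBlDr; move: p; rewrite /pos /=.
case: (lerP 0 (h x + A (omax h n) x)) => [_ _|_]; last by rewrite ltxx.
rewrite lerD2l; apply: (mk_le mA) => y.
exact: omaxS.
Qed.

(** Integrate [garsia] over [B]: its left side has integral zero because [A] preserves integrals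
    over invariant sets. *)
Lemma hopf h n B : inv B -> L1 m h -> 0 <= \int[m]_(x in B) (h x * \1_(pos h n) x).
Proof.
move=> iB Lh; have mB := inv_measurable iB; have LF := omax_L1 n Lh.
have LAF := mk_L1 mA LF.
apply: (@le_trans _ _ (\int[m]_(x in B) (omax h n x - A (omax h n) x))).
  by rewrite intB// (mk_int mA)// subrr.
apply: int_le => //; first exact: L1B.
  by apply: L1_indic => //; exact: pos_measurable.
by move=> x _; exact: garsia.
Qed.

Lemma weak_type h n a : L1 m h -> 0 < a ->
  (m (pos (fun x => `|h x| - a)%R n) <= (a^-1 * \int[m]_x `|h x|)%R%:E)%E.
Proof.
move=> Lh a0; set f := (fun x => `|h x| - a).
have Labs := L1_abs Lh.
have Lf : L1 m f by apply: L1B => //; exact: L1cst.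
have mp := pos_measurable n Lf.
have fin : m (pos f n) \is a fin_num by exact: fin_num_measure.
rewrite -(fineK fin) lee_fin -(ler_pM2l a0) mulVKf ?gt_eqF//.
have := hopf n invT Lf; rewrite -int_indic intB//; last exact: L1cst.
rewrite int_cst// subr_ge0 => /le_trans; apply.
rewrite int_indic; apply: int_le => //; first exact: L1_indic.
by move=> x _; rewrite indicE ler_piMr//; case: (_ \in _).
Qed.

Lemma weak_type_bigcup h a : L1 m h -> 0 < a ->
  (m (\bigcup_n pos (fun x => `|h x| - a)%R n) <= (a^-1 * \int[m]_x `|h x|)%R%:E)%E.
Proof.
move=> Lh a0; set f := (fun x => `|h x| - a).
have Lf : L1 m f by apply: L1B; [exact: L1_abs|exact: L1cst].
have mp n := pos_measurable n Lf.
have nd : nondecreasing_seq (pos f).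
  apply/nondecreasing_seqP => n; apply/subsetPset => x p.
  exact: lt_le_trans p (omaxS _ _ _).
have cv := @nondecreasing_cvg_mu _ _ _ m _ mp (bigcupT_measurable _ mp) nd.
rewrite -(cvg_lim _ cv)//; apply: lime_le; first by apply/cvg_ex; eexists; exact: cv.
by apply: nearW => n; exact: weak_type.
Qed.

(** Almost every point of [B] eventually lies in [pos h n], so dominated convergence removes the
    indicator from Hopf's inequality. *)
Lemma hopf_limit h B : inv B -> L1 m h ->
  {ae m, forall x, B x -> exists n, 0 < osum h n x} -> 0 <= \int[m]_(x in B) h x.
Proof.
move=> iB Lh pos_ae; have mB := inv_measurable iB.
have mh := L1_measurable Lh.
have Lhn n : L1 m (fun x => h x * \1_(pos h n) x).
  by apply: L1_indic => //; exact: pos_measurable.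
rewrite -lee_fin EFin_int//.
have [|||||_ _ cv] := @dominated_convergence _ _ _ m B mB
  (fun n x => (h x * \1_(pos h n) x)%:E) (EFin \o h) (fun x => `|h x|%:E).
- by move=> n; apply: measurable_funTS; apply/measurable_EFinP/L1_measurable.
- by apply: measurable_funTS; apply/measurable_EFinP.
- apply: filterS pos_ae => x + Bx => /(_ Bx)[n0 Sn0] /=.
  apply: cvg_near_cst; near=> n; rewrite indicE mem_set ?mulr1//.
  rewrite /pos /=; apply: lt_le_trans Sn0 _.
  rewrite (le_trans (osum_le_omax _ _ _))// omax_nd//.
  by near: n; exact: nbhs_infty_ge.
- by apply: L1_on => //; exact: L1_abs.
- apply/aeW => x n _ /=; rewrite lee_fin normrM ler_piMr// indicE normr_nat.
  by case: (_ \in _).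
rewrite -(cvg_lim _ cv)//; apply: lime_ge; first by apply/cvg_ex; eexists; exact: cv.
by apply: nearW => n /=; rewrite -EFin_int// lee_fin hopf.
Unshelve. all: by end_near. Qed.

Lemma osumSr h n x : osum h n.+1 x = osum h n x + iter n A h x.
Proof.
elim: n x => [|n IH] x; first by rewrite /= (mk0 mA) addrC.
rewrite [LHS]/= -[in LHS]/(osum h n.+1) (eq_mk mA (IH)) (mkD mA) /=.
by rewrite addrA.
Qed.

Lemma osum_shift h n x : A (osum h n) x = osum h n x + iter n A h x - h x.
Proof. by rewrite -osumSr /=; ring. Qed.

Lemma iter_bound h K n : (forall x, `|h x| <= K) -> forall x, `|iter n A h x| <= K.
Proof. by move=> hK; elim: n => //= n IH; exact: (mk_bound mA). Qed.

Lemma osum_bound h K n x : (forall x, `|h x| <= K) -> `|osum h n x| <= n%:R * K.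
Proof.
move=> hK; elim: n => [|n IH]; first by rewrite normr0 mul0r.
rewrite osumSr -natr1 mulrDl mul1r (le_trans (ler_normD _ _))//.
by apply: lerD => //; exact: iter_bound.
Qed.

Lemma osumB h a n x : osum (fun y => h y - a) n x = osum h n x - n%:R * a.
Proof.
elim: n x => [|n IH] x /=; first by rewrite mul0r subr0.
by rewrite (eq_mk mA IH) (mkB mA) (mk_cst mA) -natr1; ring.
Qed.

Lemma osumN h n x : osum (fun y => - h y) n x = - osum h n x.
Proof.
elim: n x => [|n IH] x /=; first by rewrite oppr0.
rewrite (eq_mk mA IH) opprD; congr (_ + _).
by rewrite -mulN1r -(mkZ mA); apply: (eq_mk mA) => y; rewrite mulN1r.
Qed.

(** Average over [k < n] the identity expressing [h - A^k h] as [osum h k - A (osum h k)]; the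
    remainder is the Cesaro mean of [h]. *)
Lemma coboundary h n x : (0 < n)%N ->
  let phi y := n%:R^-1 * \sum_(k < n) osum h k y in
  h x = (phi x - A phi x) + n%:R^-1 * osum h n x.
Proof.
move=> n0 phi; rewrite /phi (mkZ mA) (mk_sum mA) -mulrBr -sumrB -mulrDr.
apply: (canRL (mulKf _)); first by rewrite pnatr_eq0 -lt0n.
under eq_bigr do rewrite osum_shift.
elim: n {n0 phi} => [|n IH]; first by rewrite big_ord0 mul0r addr0.
rewrite big_ord_recr /= -[_ + A _ _]/(osum h n.+1 x) osumSr -natr1 mulrDl IH; ring.
Qed.
End Hopf.

(** * Cesaro means of a symmetric average *)

Section LimSup.
Variable R : realType.
Implicit Type u : R^nat.

Lemma bounded_seq_ubound u K : (forall n, `|u n| <= K) -> has_ubound (range u).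
Proof. by move=> uK; exists K => _ [n _ <-]; rewrite (le_trans (ler_norm _)). Qed.

Lemma bounded_seq_lbound u K : (forall n, `|u n| <= K) -> has_lbound (range u).
Proof. by move=> uK; exists (- K) => _ [n _ <-]; have := uK n; rewrite ler_norml => /andP[]. Qed.

Lemma bounded_seq_fun u K : (forall n, `|u n| <= K) -> bounded_fun u.
Proof.
move=> uK; exists K; split; first by rewrite num_real.
by move=> M KM n _ /=; rewrite (le_trans (uK n))// ltW.
Qed.

Lemma limn_sup_le u K c : (forall n, `|u n| <= K) ->
  (\forall n \near \oo, u n <= c) -> limn_sup u <= c.
Proof.
move=> uK [N _ uc]; have bu := bounded_seq_fun uK.
rewrite (limn_supE bu); apply: (@le_trans _ _ (sups u N)).
  apply: ge_inf; first exact: bounded_fun_has_lbound_sups.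
  by exists N.
apply: ge_sup; first by exists (u N), N => /=.
by move=> _ [n /= Nn <-]; exact: uc.
Qed.

Lemma limn_sup_lt_near u K c : (forall n, `|u n| <= K) -> limn_sup u < c ->
  \forall n \near \oo, u n < c.
Proof.
move=> uK; have bu := bounded_seq_fun uK; rewrite (limn_supE bu) => uc.
have ne : range (sups u) !=set0 by exists (sups u 0%N), 0%N.
have [_ [N _ <-] supc] := inf_lt ne uc.
exists N => // n /= Nn; apply: le_lt_trans supc.
apply: ub_le_sup; last by exists n.
by exists K => _ [k _ <-]; rewrite (le_trans (ler_norm _)).
Qed.

Lemma limn_sup_bound u K : (forall n, `|u n| <= K) -> `|limn_sup u| <= K.
Proof.
move=> uK; rewrite ler_norml; apply/andP; split; last first.
  apply: (limn_sup_le uK); apply: nearW => n; exact: le_trans (ler_norm _) (uK n).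
rewrite leNgt; apply/negP => /(limn_sup_lt_near uK)[N _ /(_ N (leqnn N))] /=.
by apply/negP; rewrite -leNgt; have := uK N; rewrite ler_norml => /andP[].
Qed.

Lemma near_inv_lt (c e : R) : 0 < e -> \forall n \near \oo, n.+1%:R^-1 * c < e.
Proof.
move=> e0; near=> n; rewrite mulrC ltr_pdivrMr ?ltr0n// -ltr_pdivrMl//.
rewrite mulrC (@lt_trans _ _ n%:R)// ?ltr_nat//; near: n; exact: nbhs_infty_gtr.
Unshelve. all: by end_near. Qed.
End LimSup.

(** * The ergodic theorem for the average of finitely many measure-preserving maps *)

Section Symmetric.
Variables (R : realType) (d : measure_display) (X : measurableType d).
Variable m : probability X R.
Variables (L : finType) (T : L -> X -> X) (iv : L -> L).
Hypothesis L_gt0 : (0 < #|L|)%N.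
Hypothesis TK : forall l x, T (iv l) (T l x) = x.
Hypothesis T_measurable : forall l, measurable_fun setT (T l).
Hypothesis T_mp : forall l B, measurable B -> m (T l @^-1` B) = m B.
Implicit Types (f g h u : X -> R).

Definition Tinv (B : set X) := measurable B /\ forall l, T l @^-1` B = B.

Definition Tavg f x : R := #|L|%:R^-1 * \sum_l f (T l x).

Lemma Tinv_measurable B : Tinv B -> measurable B. Proof. by case. Qed.
Lemma TinvT : Tinv setT. Proof. by split. Qed.

Lemma T_markov l : markov_op m Tinv (fun f x => f (T l x)).
Proof.
by apply: (markov_comp Tinv_measurable) => //; [exact: T_mp|move=> B []].
Qed.

Lemma Tavg_markov : markov_op m Tinv Tavg.
Proof.
have sz : size (index_enum L) = #|L| by rewrite cardT enumT.
have := @markov_mean _ _ _ m Tinv Tinv_measurable L (index_enum L) (fun l f x => f (T l x)).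
by rewrite sz; apply => // l; exact: T_markov.
Qed.

Lemma ae_T l (P : X -> Prop) : {ae m, forall x, P x} -> {ae m, forall x, P (T l x)}.
Proof.
move=> [N [mN N0 PN]]; exists (T l @^-1` N); split.
- by rewrite -[_ @^-1` _]setTI; exact: T_measurable.
- by rewrite T_mp.
- by move=> x /= nP; exact: PN.
Qed.

(* Since each [T l] preserves [m], the integral of the sum over [l] of
   [(u o T l - u) ^+ 2] is [2 #|L|] times that of [u ^+ 2 - u * Tavg u]. *)
Lemma harmonic_invariant u K : measurable_fun setT u -> (forall x, `|u x| <= K) ->
  {ae m, forall x, Tavg u x = u x} -> {ae m, forall x, forall l, u (T l x) = u x}.
Proof.
move=> mu uK hu.
have mT l : measurable_fun setT (fun x => u (T l x)) by exact: measurableT_comp.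
have L2 f g : measurable_fun setT f -> measurable_fun setT g ->
    (forall x, `|f x| <= K) -> (forall x, `|g x| <= K) -> L1 m (fun x => f x * g x).
  move=> mf mg fK gK; apply: (@L1_bounded _ _ _ _ _ (K * K)).
    exact: measurable_funM.
  by move=> x; rewrite normrM ler_pM.
have Lsq l : L1 m (fun x => (u (T l x) - u x) * (u (T l x) - u x)).
  have := L1D (L1B (L2 _ _ (mT l) (mT l) _ _) (L1Z 2 (L2 _ _ (mT l) mu _ _)))
    (L2 _ _ mu mu uK uK).
  move=> /(_ (fun x => uK _) (fun x => uK _) (fun x => uK _) uK).
  by congr (L1 m _); apply/funext => x; ring.
pose F x := \sum_l (u (T l x) - u x) * (u (T l x) - u x).
have LF : L1 m F by exact: L1_sum.
have F0 x : 0 <= F x by apply: sumr_ge0 => l _; rewrite -expr2 sqr_ge0.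
have Lc l : L1 m (fun x => u (T l x) * u x) by exact: (L2 _ _ (mT l) mu (fun=> uK _) uK).
have Luu : L1 m (fun x => u x * u x) by exact: L2.
have mTu := mk_measurable Tavg_markov mu.
have IF : \int[m]_x F x = 0.
  rewrite int_sum//.
  have E l : \int[m]_x ((u (T l x) - u x) * (u (T l x) - u x)) =
      2 * \int[m]_x (u x * u x) - 2 * \int[m]_x (u (T l x) * u x).
    have LT := mk_L1 (T_markov l) Luu.
    have L2Tu := L1Z 2 (Lc l).
    rewrite (@eq_Rintegral _ _ _ _ _
      (fun x => (u (T l x) * u (T l x) - 2 * (u (T l x) * u x)) + u x * u x)); last first.
      by move=> x _; ring.
    rewrite (intD measurableT (L1B LT L2Tu) Luu) (intB measurableT LT L2Tu).
    rewrite [X in X - _ + _](mk_int (T_markov l) TinvT Luu) (intZ 2 measurableT (Lc l)).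
    by ring.
  rewrite (eq_bigr _ (fun l _ => E l)) sumrB sumr_const -mulr_sumr -int_sum//.
  have -> : \int[m]_x (\sum_l u (T l x) * u x) = \int[m]_x (#|L|%:R * (Tavg u x * u x)).
    apply: eq_Rintegral => x _; rewrite -mulr_suml mulrA; congr (_ * _).
    by rewrite /Tavg mulVKf// pnatr_eq0 -lt0n.
  have LTu : L1 m (fun x => Tavg u x * u x).
    exact: L2 mTu mu (mk_bound Tavg_markov uK) uK.
  rewrite intZ// (int_ae_eq measurableT LTu Luu); last first.
    by apply: filterS hu => x ->.
  by rewrite -mulr_natl; ring.
have := int_ae0 LF F0 IF; apply: filterS => x Fx0 l.
have := psumr_eq0P _ Fx0; move=> /(_ _ l isT)/eqP H.
apply/eqP; rewrite -subr_eq0; move: H; rewrite mulf_eq0 orbb; apply.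
by move=> i _; rewrite -expr2 sqr_ge0.
Qed.

(** Finite compositions of the maps, enumerated by naturals so that countable unions and countably
    many null sets can be used. An index that decodes to no word gives the identity. *)
Definition Twalk (n : nat) (x : X) : X :=
  foldl (fun y l => T l y) x (odflt [::] (unpickle n)).

Lemma Twalk_measurable n : measurable_fun setT (Twalk n).
Proof.
rewrite /Twalk; elim: (odflt _ _) => [|l s IH] /=; first exact: measurable_id.
exact: measurableT_comp IH (T_measurable l).
Qed.

Lemma Twalk_ae u : {ae m, forall x, forall l, u (T l x) = u x} ->
  {ae m, forall x, forall n, u (Twalk n x) = u x}.
Proof.
move=> hu; apply: ae_foralln => n; rewrite /Twalk.
elim: (odflt _ _) => [|l s IH] /=; first exact: aeW.
by apply: filterS2 hu (ae_T l IH) => x hx ->.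
Qed.

(** The points whose orbit meets [P]: prefixing a walk with [l] or with [iv l] gives the two
    inclusions. *)
Lemma Twalk_saturated (P : set X) : measurable P ->
  Tinv [set x | exists n, P (Twalk n x)].
Proof.
move=> mP; split.
  rewrite (_ : [set x | _] = \bigcup_n (Twalk n @^-1` P)); last first.
    by apply/seteqP; split=> x [n]; [exists n|move=> _; exists n].
  apply: bigcupT_measurable => n; rewrite -[_ @^-1` _]setTI.
  exact: Twalk_measurable.
move=> l; apply/seteqP; split=> x /= [n Pn].
  by exists (pickle (l :: odflt [::] (unpickle n))); rewrite /Twalk pickleK.
exists (pickle (iv l :: odflt [::] (unpickle n))); rewrite /Twalk pickleK /=.
by rewrite TK.
Qed.

Section cesaro.
Variables (h : X -> R) (K : R).
Hypothesis mh : measurable_fun setT h.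
Hypothesis hK : forall x, `|h x| <= K.
Hypothesis h0 : forall B, Tinv B -> \int[m]_(x in B) h x = 0.

Let a n x : R := n.+1%:R^-1 * osum Tavg h n.+1 x.
Let u x : R := limn_sup (fun n => a n x).

Let Lh : L1 m h. Proof. exact: (L1_bounded m mh hK). Qed.

Let aK n x : `|a n x| <= K.
Proof.
rewrite /a normrM ger0_norm ?invr_ge0//.
rewrite -(@ler_pM2l _ n.+1%:R) ?ltr0n// mulVKf ?pnatr_eq0//.
exact: (osum_bound Tavg_markov).
Qed.

Let ma n : measurable_fun setT (a n).
Proof. by apply: measurable_funM => //; exact: (osum_measurable Tavg_markov n.+1 mh). Qed.

Let uK x : `|u x| <= K. Proof. exact: limn_sup_bound. Qed.

Let mu : measurable_fun setT u.
Proof.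
apply: measurable_fun_limn_sup => // x _.
  exact: (@bounded_seq_ubound _ _ K).
exact: (@bounded_seq_lbound _ _ K).
Qed.

(** [Tavg (a n)] differs from [a n] by at most [2 * K / (n + 1)], and since [L] is finite, one
    threshold for [n] serves all the points [T l x]. *)
Let u_subharmonic x : u x <= Tavg u x.
Proof.
apply/ler_addgt0Pl => e e0; rewrite addrC.
apply: (limn_sup_le (fun n => aK n x)).
have e2 : 0 < e / 2 by rewrite divr_gt0.
have ev l : \forall n \near \oo, a n (T l x) < u (T l x) + e / 2.
  by apply: (limn_sup_lt_near (fun n => aK n _)); rewrite ltrDl.
have evall : \forall n \near \oo, forall l, a n (T l x) < u (T l x) + e / 2.
  exact: filter_forall.
near=> n.
have A1 : Tavg (a n) x <= Tavg u x + e / 2.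
  rewrite -(mk_cst Tavg_markov (e / 2) x) -(mkD Tavg_markov).
  rewrite /Tavg ler_wpM2l ?invr_ge0// ler_sum// => l _; apply: ltW.
  by move: l; near: n; exact: filter_forall.
have A2 : a n x <= Tavg (a n) x + n.+1%:R^-1 * (2 * K).
  rewrite (mkZ Tavg_markov) (osum_shift Tavg_markov) -mulrDr ler_wpM2l ?invr_ge0//.
  have := iter_bound Tavg_markov n.+1 hK x; have := hK x.
  by rewrite !ler_norml => /andP[? ?] /andP[? ?]; lra.
have A3 : n.+1%:R^-1 * (2 * K) < e / 2 by near: n; exact: near_inv_lt.
by rewrite (le_trans A2)// (splitr e) addrA lerD// ltW.
Unshelve. all: by end_near. Qed.

(** [Tavg u - u] is nonnegative with zero integral, so [u] is harmonic almost everywhere and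
    [harmonic_invariant] applies. *)
Let u_invariant : {ae m, forall x n, u (Twalk n x) = u x}.
Proof.
have Lu := L1_bounded m mu uK; have LTu := mk_L1 Tavg_markov Lu.
apply/Twalk_ae/(harmonic_invariant mu uK).
have Pu0 : {ae m, forall x, Tavg u x - u x = 0}.
  apply: int_eq0_negligible => [|x|]; first exact: (L1B LTu Lu).
    by rewrite subr_ge0.
  by rewrite (intB measurableT LTu Lu) (mk_int Tavg_markov TinvT Lu) subrr.
by apply: filterS Pu0 => x /eqP; rewrite subr_eq0 => /eqP.
Qed.

(** Where [u > e / 2], some partial sum of [h - e / 2] is positive. Hopf's inequality on the
    invariant set [B] then bounds [(e / 2) * m B] by the integral of [h] over [B], which is zero. *)
Lemma cesaro_lt (e : R) : 0 < e ->
  {ae m, forall x, \forall n \near \oo, n.+1%:R^-1 * osum Tavg h n.+1 x < e}.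
Proof.
move=> e0; have e2 : 0 < e / 2 by rewrite divr_gt0.
pose P := [set x | e / 2 < u x].
have mP : measurable P.
  have -> : P = u @^-1` `]e / 2, +oo[%classic.
    by apply/seteqP; split=> x /=; rewrite /P in_itv /= andbT.
  by rewrite -[_ @^-1` _]setTI; exact: mu.
(* [u] is invariant only almost everywhere, so [P] need not be an invariant set; its saturation is
   one. *)
pose B := [set x | exists n, P (Twalk n x)].
have iB : Tinv B := Twalk_saturated mP.
have mB := Tinv_measurable iB.
have : 0 <= \int[m]_(x in B) (h x - e / 2).
  apply: (hopf_limit Tinv_measurable Tavg_markov iB).
    by apply: L1B => //; exact: L1cst.
  apply: filterS u_invariant => x ux [n]; rewrite /P /= ux => eu.
  apply: contrapT => H; move: eu; apply/negP; rewrite -leNgt.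
  apply: (limn_sup_le (fun n => aK n x)); apply: nearW => k.
  rewrite leNgt; apply/negP => ek; apply: H; exists k.+1.
  rewrite (osumB Tavg_markov) subr_gt0 mulrC -ltr_pdivlMr ?ltr0n//.
  by rewrite [ltRHS]mulrC.
rewrite intB//; last exact: L1cst.
rewrite h0// sub0r int_cst// oppr_ge0 pmulr_rle0// => mB0.
have B0 : m B = 0%E.
  rewrite -(fineK (fin_num_measure m _ mB)); congr _%:E.
  by apply/eqP; rewrite eq_le mB0 fine_ge0.
have : {ae m, forall x, ~ B x} by exists B; split => // x /=; exact: contrapT.
apply: filterS => x nB; apply: (limn_sup_lt_near (fun n => aK n x)).
rewrite (@le_lt_trans _ _ (e / 2))//; last by rewrite ltr_pdivrMr// mulr2n mulrDr mulr1 ltrDl.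
rewrite leNgt; apply/negP => eu; apply: nB; exists (pickle ([::] : seq L)).
by rewrite /Twalk pickleK.
Qed.
End cesaro.

Lemma cesaro_cvg0 h K : measurable_fun setT h -> (forall x, `|h x| <= K) ->
  (forall B, Tinv B -> \int[m]_(x in B) h x = 0) ->
  {ae m, forall x, (fun n => n.+1%:R^-1 * osum Tavg h n.+1 x) @ \oo --> 0}.
Proof.
move=> mh hK h0.
have mh' : measurable_fun setT (fun x => - h x) by exact: measurable_funN.
have hK' x : `|- h x| <= K by rewrite normrN.
have h0' B : Tinv B -> \int[m]_(x in B) (- h x) = 0.
  move=> iB; have mB := Tinv_measurable iB.
  under eq_Rintegral do rewrite -mulN1r.
  by rewrite intZ ?h0 ?mulr0//; exact: (L1_bounded m mh hK).
have H1 := ae_foralln (fun k => cesaro_lt mh hK h0 (e := k.+1%:R^-1) (ltac:(by [])) ).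
have H2 := ae_foralln (fun k => cesaro_lt mh' hK' h0' (e := k.+1%:R^-1) (ltac:(by [])) ).
apply: filterS2 H1 H2 => x H1 H2; apply/cvgrPdist_lt => e e0.
have [k _ /(_ k (leqnn k)) /= ke] := near_inv_lt 1 e0.
rewrite mulr1 in ke; near=> n; rewrite sub0r normrN ltr_norml.
apply/andP; split; last by apply: lt_trans ke; near: n; exact: H1.
have : n.+1%:R^-1 * osum Tavg (fun y => - h y) n.+1 x < k.+1%:R^-1 by near: n; exact: H2.
by rewrite (osumN Tavg_markov) mulrN ltrNl => kn; apply: lt_trans kn; rewrite ltrN2.
Unshelve. all: by end_near. Qed.

Lemma cesaro_L1 h K e : measurable_fun setT h -> (forall x, `|h x| <= K) ->
  (forall B, Tinv B -> \int[m]_(x in B) h x = 0) -> 0 < e ->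
  exists n, \int[m]_x `|n.+1%:R^-1 * osum Tavg h n.+1 x| < e.
Proof.
move=> mh hK h0 e0.
pose a n x := n.+1%:R^-1 * osum Tavg h n.+1 x.
have ma n : measurable_fun setT (a n).
  by apply: measurable_funM => //; exact: (osum_measurable Tavg_markov n.+1 mh).
have aK n x : `|a n x| <= K.
  rewrite /a normrM ger0_norm ?invr_ge0//.
  rewrite -(@ler_pM2l _ n.+1%:R) ?ltr0n// mulVKf ?pnatr_eq0//.
  exact: (osum_bound Tavg_markov).
have [|||||_ cv _] := @dominated_convergence _ _ _ m setT measurableT
  (fun n x => (a n x)%:E) (cst 0%E) (cst K%:E).
- by move=> n; exact/measurable_EFinP.
- exact: measurable_cst.
- apply: filterS (cesaro_cvg0 mh hK h0) => x ax _.
  by apply: cvg_EFin => //; exact: nearW.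
- exact: L1cst.
- by apply/aeW => x n _; rewrite lee_fin.
have /fine_cvgP[_ /cvgrPdist_lt/(_ e e0)[n _ /(_ n (leqnn n))]] := cv.
move=> H; exists n; apply: le_lt_trans H; rewrite /= sub0r normrN.
rewrite (le_trans _ (ler_norm _))// /Rintegral le_eqVlt; apply/orP; left; apply/eqP.
by congr fine; apply: eq_integral => x _ /=; rewrite subr0.
Qed.
End Symmetric.

(** * Conditional expectation *)

(* The conditional expectation is the Radon-Nikodym derivative of
   [B |-> \int_B f], restricted to [inv], transported along the identity map. *)
Section CondExp.
Variables (R : realType) (d : measure_display) (X : measurableType d).
Variable m : probability X R.
Variable inv : set X -> Prop.
Hypothesis inv_measurable : forall B, inv B -> measurable B.
Hypothesis inv_sigma : sigma_algebra setT inv.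

(** A copy of [X] in which only the sets of [inv] are measurable. *)
Let Y := g_sigma_algebraType inv.

Let idY : X -> Y := id.

Let measY (B : set X) : measurable (B : set Y) <-> inv B.
Proof.
rewrite /measurable /= (_ : <<s inv >> = inv)//.
exact: sigma_algebra_id.
Qed.

Let midY : measurable_fun setT idY.
Proof. by move=> _ B /measY/inv_measurable; rewrite setTI. Qed.

Definition invariant_prob (B : set Y) : \bar R := m (B : set X).

Let invariant_prob0 : invariant_prob set0 = 0%E. Proof. exact: measure0. Qed.

Let invariant_prob_ge0 B : (0 <= invariant_prob B)%E. Proof. exact: measure_ge0. Qed.

Let invariant_prob_sigma : semi_sigma_additive invariant_prob.
Proof.
move=> F mF tF mUF; apply: (measure_semi_sigma_additive (s := m)) => //.
  by move=> i; exact/inv_measurable/measY.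
exact/inv_measurable/measY.
Qed.

HB.instance Definition _ := isMeasure.Build _ Y R invariant_prob invariant_prob0 invariant_prob_ge0 invariant_prob_sigma.

Let invariant_probT : invariant_prob setT = 1%E. Proof. exact: probability_setT. Qed.

HB.instance Definition _ := Measure_isProbability.Build _ Y R invariant_prob invariant_probT.

Section derivative.
Variable f : X -> R.
Hypothesis Lf : L1 m f.

Definition invariant_charge (B : set Y) : \bar R := induced_charge Lf (B : set X).

Let invariant_charge0 : invariant_charge set0 = 0%E. Proof. exact: charge0. Qed.

Let invariant_charge_fin B : measurable B -> invariant_charge B \is a fin_num.
Proof. by move=> mB; apply: fin_num_measure; exact/inv_measurable/measY. Qed.

Let invariant_charge_sigma : semi_sigma_additive invariant_charge.
Proof.
move=> F mF tF mUF; apply: (charge_semi_sigma_additive (s := induced_charge Lf)) => //.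
  by move=> i; exact/inv_measurable/measY.
exact/inv_measurable/measY.
Qed.

HB.instance Definition _ := isCharge.Build _ Y R invariant_charge invariant_charge0 invariant_charge_fin invariant_charge_sigma.

Let invariant_charge_dominated : invariant_charge `<< invariant_prob.
Proof.
apply/null_content_dominatesP => B mB B0.
apply: null_set_integral => //; first exact/inv_measurable/measY.
by apply: measurable_funTS; exact: measurable_int Lf.
Qed.

Lemma cond_exp_exists : exists g : X -> R,
  [/\ forall B : set R, measurable B -> inv (g @^-1` B), L1 m g &
   forall B, inv B -> \int[m]_(x in B) g x = \int[m]_(x in B) f x].
Proof.
pose D : Y -> \bar R := Radon_Nikodym invariant_charge invariant_prob.
have Dfin x : D x \is a fin_num by exact: Radon_Nikodym_fin_num.
have LD : (invariant_prob : {measure set Y -> \bar R}).-integrable setT D by exact: Radon_Nikodym_integrable.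
have intD B : inv B -> invariant_charge B = (\int[invariant_prob]_(x in B) D x)%E.
  by move=> /measY mB; exact: Radon_Nikodym_integral.
pose g : X -> R := fun x => fine (D x).
have gD : EFin \o g = D \o idY by apply/funext => x /=; rewrite fineK.
have mD : measurable_fun setT D := measurable_int _ LD.
have ginv (B : set R) : measurable B -> inv (g @^-1` B).
  move=> mB; apply/measY; rewrite -[_ @^-1` _]setTI.
  have mf : measurable_fun setT (fine \o D) by exact: measurableT_comp.
  exact: mf.
have mg : measurable_fun setT g by move=> _ B /ginv/inv_measurable; rewrite setTI.
have pE B (k : Y -> \bar R) : measurable B ->
    (\int[pushforward m idY]_(x in B) k x = \int[invariant_prob]_(x in B) k x)%E.
  by move=> mB; apply: eq_measure_integral => C mC _.
have Lg : L1 m g.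
  apply/integrableP; split; first exact/measurable_EFinP.
  have /integrableP[_] := LD; rewrite -pE// ge0_integral_pushforward//.
    by apply: le_lt_trans; rewrite gD.
  exact: measurableT_comp.
exists g; split => // B iB; rewrite /Rintegral; congr fine.
have mB : measurable (B : set Y) by exact/measY.
have LB : m.-integrable (idY @^-1` B) (D \o idY).
  by rewrite -gD; exact: L1_on (inv_measurable iB) Lg.
rewrite -[RHS]/(invariant_charge B) intD// -(pE B)//.
by rewrite (integral_pushforward midY mD LB mB) -gD.
Qed.
End derivative.
End CondExp.

(** * Radial averages *)

Section Kernel.
Variable R : realType.

(* The radial walk steps up with probability [1 - b = q / (q + 1)] and down with
   probability [b <= 1 / 4].  Since [(1 - b) / 2 + 2 b <= 7 / 8], the function
   [2 ^ j (7 / 8) ^ N] is a supersolution of its heat equation, so [subsol] bounds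
   its Green function up to time [N] from below. *)
Definition subsol (N j : nat) : R := Num.max 0 (1 - 2 ^+ j * (7 / 8) ^+ N).

Lemma subsol_ge0 N j : 0 <= subsol N j.
Proof. by rewrite le_max lexx. Qed.

Lemma subsol_le1 N j : subsol N j <= 1.
Proof.
by rewrite ge_max ler01 gerBl mulr_ge0// exprn_ge0// divr_ge0.
Qed.

Lemma subsol0 j : subsol 0 j = 0.
Proof. by apply/max_l; rewrite expr0 mulr1 subr_le0 exprn_ege1// ler1n. Qed.

Lemma subsolS (b : R) N j : 0 <= b <= 1 / 4 ->
  subsol N.+1 j.+1 <= (1 - b) * subsol N j + b * subsol N j.+2.
Proof.
move=> /andP[b0 b4]; rewrite {1}/subsol ge_max; apply/andP; split.
  by rewrite addr_ge0// mulr_ge0// ?subsol_ge0//; lra.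
(* With [z = 2 ^ j (7 / 8) ^ N] the affine branches compare as [1 + 3 b <= 7 / 4] times [z], which
   is the condition [b <= 1 / 4]. *)
apply: (@le_trans _ _ ((1 - b) * (1 - 2 ^+ j * (7 / 8) ^+ N) +
                       b * (1 - 2 ^+ j.+2 * (7 / 8) ^+ N))).
  rewrite !exprS; set w := 2 ^+ j; set t := (7 / 8) ^+ N.
  have : 0 <= w * t by rewrite mulr_ge0// exprn_ge0// divr_ge0.
  rewrite -[2 * w * _]/(2 * w * _).
  have -> : 2 * w * (7 / 8 * t) = 7 / 4 * (w * t) by field.
  have -> : 2 * (2 * w) * t = 4 * (w * t) by ring.
  move: (w * t) => z z0; nra.
by apply: lerD; rewrite ler_wpM2l// ?le_max ?lexx ?orbT//; lra.
Qed.

(** The factor 6 comes from [(7 / 8) ^ 6 <= 1 / 2]: at time [6 (n + 1)] the decay is at most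
    [2 ^ -(n + 1)], against a growth of at most [2 ^ n]. *)
Lemma subsol_ge_half n j : (j <= n)%N -> 1 / 2 <= subsol (6 * n.+1) j.
Proof.
move=> jn; rewrite le_max; apply/orP; right.
suff : 2 ^+ j * (7 / 8) ^+ (6 * n.+1) <= 1 / 2 :> R by lra.
have H : (7 / 8) ^+ 6 <= 1 / 2 :> R by lra.
rewrite exprM; apply: (@le_trans _ _ (2 ^+ n * (1 / 2) ^+ n.+1)).
  apply: ler_pM; rewrite ?exprn_ge0 ?divr_ge0//.
    by rewrite ler_weXn2l// ler1n.
  by rewrite lerXn2r// ?nnegrE ?exprn_ge0 ?divr_ge0.
by rewrite exprS mulrCA -exprMn (_ : 2 * (1 / 2) = 1) ?expr1n ?mulr1//; field.
Qed.

Lemma sum_widen (F : nat -> R) n k : (forall j, 0 <= F j) ->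
  \sum_(j < n) F j <= \sum_(j < n + k) F j.
Proof.
move=> F0; elim: k => [|k IH]; first by rewrite addn0.
by rewrite addnS big_ord_recr /= (le_trans IH)// lerDl.
Qed.

(** With [y j] standing for [s j f x], the right side is [f x] plus [A] applied to the weighted
    sphere sum at time [N]. *)
Lemma subsol_step (b : R) (y : nat -> R) N J : 0 <= b <= 1 / 4 ->
  (forall j, 0 <= y j) ->
  \sum_(j < J) subsol N.+1 j * y j <= y 0%N + (subsol N 0 * y 1%N +
    \sum_(j < J.+1) subsol N j.+1 * ((1 - b) * y j.+2 + b * y j)).
Proof.
move=> b04 y0; have /andP[b0 b4] := b04.
(* [c j] collects the source at level 0 and the upward steps. At level 1 the walk arrives from 0
   with probability 1, so the factor [1 - b] there is a harmless loss. *)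
pose c j := if j is j'.+1 then (1 - b) * subsol N j' else 1.
have c0 j : 0 <= c j.
  by case: j => [|j] /=; rewrite ?ler01// mulr_ge0 ?subsol_ge0//; lra.
have gc j : subsol N.+1 j <= c j + b * subsol N j.+1.
  case: j => [|j] /=; last exact: subsolS.
  by rewrite (le_trans (subsol_le1 _ _))// lerDl mulr_ge0 ?subsol_ge0.
apply: (@le_trans _ _ (\sum_(j < J) c j * y j + \sum_(j < J) b * subsol N j.+1 * y j)).
  by rewrite -big_split /= ler_sum// => j _; rewrite -mulrDl ler_wpM2r.
(* The ranges are widened to [J + 3] and [J + 1] so that they match once the first two terms of the
   former are split off. *)
have H1 := @sum_widen (fun j => c j * y j) J 3 (fun j => mulr_ge0 (c0 j) (y0 j)).
have H2 := @sum_widen (fun j => b * subsol N j.+1 * y j) J 1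
  (fun j => mulr_ge0 (mulr_ge0 b0 (subsol_ge0 _ _)) (y0 j)).
have shift (F : nat -> R) k : \sum_(j < k.+1) F j = F 0%N + \sum_(j < k) F j.+1.
  by rewrite big_ord_recl.
apply: (le_trans (lerD H1 H2)); rewrite addn1 addn3.
rewrite (shift (fun j => c j * y j)) (shift (fun j => c j.+1 * y j.+1)) mul1r.
rewrite -!addrA lerD2l.
have -> : \sum_(j < J.+1) subsol N j.+1 * ((1 - b) * y j.+2 + b * y j) =
  \sum_(j < J.+1) (1 - b) * subsol N j.+1 * y j.+2 +
  \sum_(j < J.+1) b * subsol N j.+1 * y j.
  by rewrite -big_split; apply: eq_bigr => j _ /=; ring.
by rewrite lerD// ler_wpM2r// ler_piMl ?subsol_ge0//; lra.
Qed.
End Kernel.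

(** * The maximal inequality and almost everywhere convergence from the sphere recursion *)

Section Radial.
Variables (R : realType) (d : measure_display) (X : measurableType d).
Variable m : probability X R.
Variable inv : set X -> Prop.
Hypothesis inv_measurable : forall B, inv B -> measurable B.
Hypothesis invT : inv setT.
Variables (q : R) (s : nat -> (X -> R) -> X -> R).
Hypothesis q3 : 3 <= q.
Hypothesis ms : forall k, markov_op m inv (s k).
Hypothesis s0 : forall f x, s 0 f x = f x.
Hypothesis s_rec : forall f k x,
  (q + 1) * s 1 (s k.+1 f) x = q * s k.+2 f x + s k f x.
Implicit Types (f g h phi : X -> R).

Local Notation A := (s 1).

Definition smean n f x : R := n.+1%:R^-1 * \sum_(k < n.+1) s k f x.

Let q1 : 0 < q + 1. Proof. by move: q3; lra. Qed.

Lemma smean_markov n : markov_op m inv (smean n).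
Proof.
have sz : size (index_enum 'I_n.+1) = n.+1 by rewrite -[RHS]card_ord cardT enumT.
have := @markov_mean _ _ _ m inv inv_measurable 'I_n.+1 (index_enum 'I_n.+1) (fun k => s k).
by rewrite sz; apply.
Qed.

(** Induction on the time [N], with [J] general because one application of [A] calls for two more
    levels. *)
Lemma osum_ge_radial f N J x : (forall y, 0 <= f y) ->
  \sum_(j < J) subsol R N j * s j f x <= osum A f N x.
Proof.
move=> f0; elim: N J x => [|N IH] J x.
  by rewrite big1// => j _; rewrite subsol0 mul0r.
rewrite /=; set b := (q + 1)^-1.
have b04 : 0 <= b <= 1 / 4.
  by rewrite invr_ge0 ltW//= div1r lef_pV2 ?posrE//; move: q3; lra.
have sb k : A (s k.+1 f) x = (1 - b) * s k.+2 f x + b * s k f x.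
  apply: (mulfI (lt0r_neq0 q1)); rewrite s_rec /b; field; exact: lt0r_neq0.
have y0 j : 0 <= s j f x by exact: (mk_ge0 (ms j)).
apply: (le_trans (subsol_step N J b04 y0)); rewrite s0 lerD2l.
apply: (@le_trans _ _ (A (fun y => \sum_(j < J.+2) subsol R N j * s j f y) x)).
  rewrite (mk_sum (ms 1)) [leRHS]big_ord_recl /= (mkZ (ms 1)) (eq_mk (ms 1) (s0 f)) lerD2l.
  by apply: ler_sum => j _; rewrite (mkZ (ms 1)) sb.
by apply: (mk_le (ms 1)) => y; exact: IH.
Qed.

Lemma radial_le_osum f n x : (forall y, 0 <= f y) ->
  \sum_(k < n.+1) s k f x <= 2 * osum A f (6 * n.+1) x.
Proof.
move=> f0; rewrite -ler_pdivrMl//; apply: le_trans (osum_ge_radial _ n.+1 _ f0).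
rewrite mulr_sumr ler_sum// => j _; rewrite ler_wpM2r ?(mk_ge0 (ms j))//.
by rewrite -[leLHS]mul1r subsol_ge_half// -ltnS.
Qed.

Lemma bigcup_smean_measurable f a : measurable_fun setT f ->
  measurable (\bigcup_n [set x | (a < `|smean n f x|)%R]).
Proof.
move=> mf; apply: bigcupT_measurable => n.
have msf := mk_measurable (smean_markov n) mf.
have -> : [set x | a < `|smean n f x|] = (fun x => `|smean n f x|) @^-1` `]a, +oo[%classic.
  by apply/seteqP; split=> x /=; rewrite in_itv /= andbT.
have mn : measurable_fun setT (fun x => `|smean n f x|) by exact: measurableT_comp.
by rewrite -[_ @^-1` _]setTI; exact: mn.
Qed.

(** The constant is [12 = 2 * 6]: if the mean at [n] exceeds [a], then [osum A |f|] at time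
    [6 (n + 1)] exceeds [(n + 1) a / 2], so the partial sum of [|f| - a / 12] at that time is
    positive. *)
Lemma smean_maximal f a : L1 m f -> 0 < a ->
  (m (\bigcup_n [set x | (a < `|smean n f x|)%R]) <=
    (12 / a * \int[m]_x `|f x|)%R%:E)%E.
Proof.
move=> Lf a0; have a12 : 0 < a / 12 by rewrite divr_gt0.
have Lh : L1 m (fun x => `|f x| - a / 12) by apply: L1B; [exact: L1_abs|exact: L1cst].
have := weak_type_bigcup inv_measurable invT (ms 1) Lf a12.
rewrite invf_div; apply: le_trans.
apply: le_measure; rewrite ?inE.
- exact: bigcup_smean_measurable (L1_measurable Lf).
- by apply: bigcupT_measurable => n; exact: (pos_measurable (ms 1) n Lh).
move=> x [n _ /= an]; exists (6 * n.+1)%N => //; rewrite /mkset.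
apply: (lt_le_trans _ (osum_le_omax (ms 1) _ _ _)).
rewrite (osumB (ms 1)) subr_gt0.
have := radial_le_osum n x (fun y => normr_ge0 (f y)).
have := mk_abs (smean_markov n) f x; rewrite /smean => M1 M2.
have := lt_le_trans an M1; rewrite -ltr_pdivrMl ?invr_gt0 ?ltr0n// invrK => M3.
have := lt_le_trans M3 M2.
by rewrite natrM; lra.
Qed.

(** By the recursion each [s k] is a polynomial in [A]; the induction carries two consecutive
    indices. *)
Lemma s_comm k phi x : s k (A phi) x = A (s k phi) x.
Proof.
suff : forall k, (forall x, s k (A phi) x = A (s k phi) x) /\
  (forall x, s k.+1 (A phi) x = A (s k.+1 phi) x) by case/(_ k).
elim=> [|{}k [IH1 IH2]]; split => // {}x; first by rewrite s0 (eq_mk (ms 1) (s0 phi)).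
have qN0 : q != 0 by move: q3; lra.
apply: (mulfI qN0).
have := s_rec (A phi) k x; rewrite IH1 (eq_mk (ms 1) IH2).
move/(congr1 (fun t => t - A (s k phi) x)); rewrite addrK => <-.
rewrite -!(mkZ (ms 1)) -(mkB (ms 1)); apply: (eq_mk (ms 1)) => y.
by rewrite s_rec addrK.
Qed.

Lemma radial_telescope phi n x :
  (q + 1) * \sum_(k < n.+1) s k (fun y => phi y - A phi y) x =
  - q * s n.+1 phi x + s n phi x - s 1 phi x + q * phi x.
Proof.
elim: n => [|n IH].
  by rewrite big_ord_recl big_ord0 !s0; ring.
rewrite big_ord_recr /= mulrDr IH (mkB (ms _)) s_comm mulrBr s_rec; ring.
Qed.

(** The four boundary terms of [radial_telescope] add up to at most [(2 q + 2) K], and division by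
    [q + 1] leaves [2 K]. *)
Lemma smean_coboundary phi K n x : (forall y, `|phi y| <= K) ->
  `|smean n (fun y => phi y - A phi y) x| <= n.+1%:R^-1 * (2 * K).
Proof.
move=> phiK; rewrite /smean normrM ger0_norm ?invr_ge0// ler_wpM2l ?invr_ge0//.
rewrite -(ler_pM2l q1) -[X in X * `|_|](gtr0_norm q1) -normrM radial_telescope.
have := mk_bound (ms n.+1) phiK x; have := mk_bound (ms n) phiK x.
have := mk_bound (ms 1) phiK x; have := phiK x.
rewrite !ler_norml => /andP[? ?] /andP[? ?] /andP[? ?] /andP[? ?].
by move: q3 => ?; apply/andP; split; nra.
Qed.

Definition near_coboundary h := forall e : R, 0 < e -> exists phi K,
  [/\ measurable_fun setT phi, forall x, `|phi x| <= K &
   \int[m]_x `|h x - (phi x - A phi x)| < e].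

(** Split [h] into a bounded coboundary, whose means vanish uniformly, and a remainder of norm below
    [1 / (i + 1)]. The maximal inequality confines the remainder's large means to a set [G i] of
    measure [O(1 / (i + 1))]; the intersection of these sets is null. *)
Lemma smean_small h e : L1 m h -> near_coboundary h -> 0 < e ->
  {ae m, forall x, \forall n \near \oo, `|smean n h x| < e}.
Proof.
move=> Lh hh e0; have e2 : 0 < e / 2 by rewrite divr_gt0.
have H (i : nat) : exists G : set X, [/\ measurable G,
    (m G <= (i.+1%:R^-1 * (12 / (e / 2)))%:E)%E &
    forall x, ~ G x -> \forall n \near \oo, `|smean n h x| < e].
  have i0 : 0 < i.+1%:R^-1 :> R by [].
  have [phi [K [mphi phiK hphi]]] := hh _ i0.
  have LA := mk_L1 (ms 1) (L1_bounded m mphi phiK).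
  have Lcob := L1B (L1_bounded m mphi phiK) LA.
  have Lr := L1B Lh Lcob.
  exists (\bigcup_n [set x | (e / 2 < `|smean n (fun x => h x - (phi x - A phi x)) x|)%R]).
  split.
  - exact: bigcup_smean_measurable (L1_measurable Lr).
  - apply: le_trans (smean_maximal Lr e2) _.
    by rewrite lee_fin mulrC ler_wpM2r ?divr_ge0// ltW.
  move=> x nG; near=> n.
  have -> : smean n h x = smean n (fun x => h x - (phi x - A phi x)) x +
      smean n (fun x => phi x - A phi x) x.
    rewrite -(mkD (smean_markov n)); apply: (eq_mk (smean_markov n)) => y.
    by rewrite subrK.
  rewrite (le_lt_trans (ler_normD _ _))// (splitr e) ler_ltD//.
    by rewrite leNgt; apply/negP => en; apply: nG; exists n.
  apply: le_lt_trans (smean_coboundary n x phiK) _.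
  by near: n; exact: near_inv_lt.
have [G HG] := choice H.
exists (\bigcap_i G i); split.
- by apply: bigcapT_measurable => i; have [] := HG i.
- apply/eqP; rewrite -measure_le0; apply/lee_addgt0Pr => r r0; rewrite add0e.
  have [i _ /(_ i (leqnn i)) /= ir] := near_inv_lt (12 / (e / 2)) r0.
  have [mG mGi _] := HG i.
  apply: (@le_trans _ _ (m (G i))).
    apply: le_measure; rewrite ?inE//; last exact: bigcap_inf.
    by apply: bigcapT_measurable => j; have [] := HG j.
  by rewrite (le_trans mGi)// lee_fin ltW.
move=> x /= nx i _; apply: contrapT => nG; apply: nx.
by have [_ _] := HG i; apply.
Unshelve. all: by end_near. Qed.

Lemma smean_cvg0 h : L1 m h -> near_coboundary h ->
  {ae m, forall x, (fun n => smean n h x) @ \oo --> 0}.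
Proof.
move=> Lh hh.
have H k : {ae m, forall x, \forall n \near \oo, `|smean n h x| < k.+1%:R^-1}.
  exact: smean_small.
apply: filterS (ae_foralln H) => x Hx; apply/cvgrPdist_lt => e e0.
have [k _ /(_ k (leqnn k)) /= ke] := near_inv_lt 1 e0; rewrite mulr1 in ke.
near=> n; rewrite sub0r normrN; apply: lt_trans ke.
by near: n; exact: Hx.
Unshelve. all: by end_near. Qed.
End Radial.

(** * Mean convergence *)

Section Power.
Variable R : realType.
Implicit Types a b t p : R.

(** Young's inequality for [t] and [a ^ (p - 1)] with exponents [p] and [p / (p - 1)]; the case
    [p = 1] is separate because it has no finite conjugate exponent. *)
Lemma powR_tangent p a t : 1 <= p -> 0 <= a -> 0 <= t ->
  a `^ p + p * a `^ (p - 1) * (t - a) <= t `^ p.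
Proof.
move=> p1 a0 t0; have p0 : 0 < p by lra.
have := mulr_powRB1 a0 p0 => aE.
move: p1; rewrite le_eqVlt => /orP[/eqP<-|p1].
  by rewrite !powRr1// subrr powRr0; lra.
have p1' : 0 < p - 1 by lra.
have q0 : 0 < p / (p - 1) by rewrite divr_gt0.
have pq : p^-1 + (p / (p - 1))^-1 = 1.
  by rewrite invf_div -[X in X + _]mul1r -mulrDl addrC subrK divff// gt_eqF.
have := conjugate_powR t0 (powR_ge0 a (p - 1)) p0 q0 pq.
rewrite -powRrM (_ : (p - 1) * (p / (p - 1)) = p); last first.
  by rewrite mulrC divfK// gt_eqF.
rewrite invf_div -(ler_pM2l p0) mulrDr.
have -> : p * (t `^ p / p) = t `^ p by rewrite mulrC divfK// gt_eqF.
have -> : p * (a `^ p * ((p - 1) / p)) = (p - 1) * a `^ p by field; rewrite gt_eqF.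
by rewrite -aE; set c := a `^ (p - 1); nra.
Qed.

Lemma powR_normB_le p a b : 1 <= p ->
  `|a - b| `^ p <= 2 `^ p * (`|a| `^ p + `|b| `^ p).
Proof.
move=> p1; have p0 : 0 <= p by lra.
apply: (@le_trans _ _ ((2 * Num.max `|a| `|b|) `^ p)).
  rewrite ge0_ler_powR ?nnegrE ?mulr_ge0// ?le_max ?normr_ge0//.
  rewrite (le_trans (ler_normB _ _))// mulr_natl mulr2n lerD// le_max lexx ?orbT//.
rewrite powRM// ?le_max ?normr_ge0// ler_wpM2l ?powR_ge0//.
by case: (lerP `|a| `|b|) => _; rewrite ?lerDl ?lerDr powR_ge0.
Qed.
End Power.

(** * Jensen's inequality, truncation and generalised dominated convergence *)

Section Analysis.
Variables (R : realType) (d : measure_display) (X : measurableType d).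
Variable m : probability X R.
Implicit Types (f g h w : X -> R).

Lemma measurable_norm_powR f p : measurable_fun setT f ->
  measurable_fun setT (fun x => `|f x| `^ p).
Proof.
move=> mf; have mn : measurable_fun setT (fun x => `|f x|) by exact: measurableT_comp.
exact: (measurableT_comp (measurable_powR p) mn).
Qed.

(** Apply [A] to the tangent inequality at the point [A |f| x]; the linear term then cancels. *)
Lemma jensen (inv : set X -> Prop) A f p x : markov_op m inv A -> 1 <= p ->
  `|A f x| `^ p <= A (fun y => `|f y| `^ p) x.
Proof.
move=> mA p1; set a := A (fun y => `|f y|) x.
have a0 : 0 <= a by exact: (mk_ge0 mA).
apply: (@le_trans _ _ (a `^ p)).
  by rewrite ge0_ler_powR ?nnegrE ?(mk_abs mA)//; lra.
apply: le_trans (mk_le mA (fun y => powR_tangent p1 a0 (normr_ge0 (f y))) x).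
rewrite (mkD mA) (mk_cst mA) (mkZ mA) (mkB mA) (mk_cst mA) -/a subrr.
by rewrite mulr0 addr0.
Qed.

(** The cut is made by the size of a second function [w], so that the truncation set is invariant
    when [w] is. *)
Lemma L1_tail f w e : L1 m f -> measurable_fun setT w -> 0 < e ->
  exists n : nat, \int[m]_x `|f x - f x * \1_[set x | `|w x| <= n%:R] x| < e.
Proof.
move=> Lf mw e0.
have mC n : measurable [set x | `|w x| <= n%:R].
  have mn : measurable_fun setT (fun x => `|w x|) by exact: measurableT_comp.
  have -> : [set x | `|w x| <= n%:R] = (fun x => `|w x|) @^-1` `]-oo, n%:R]%classic.
    by apply/seteqP; split=> x /=; rewrite in_itv.
  by rewrite -[_ @^-1` _]setTI; exact: mn.
pose F n x := `|f x - f x * \1_[set x | `|w x| <= n%:R] x|.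
have LF n : L1 m (F n) by apply/L1_abs/L1B => //; exact: L1_indic.
have FE n x : F n x <= `|f x|.
  by rewrite /F indicE; case: (_ \in _); rewrite ?mulr1 ?mulr0 ?subr0 ?subrr ?normr0.
have [|||||_ _ cv] := @dominated_convergence _ _ _ m setT measurableT
  (fun n x => (F n x)%:E) (cst 0%E) (fun x => `|f x|%:E).
- by move=> n; apply/measurable_EFinP/L1_measurable.
- exact: measurable_cst.
- apply/aeW => x _; apply: cvg_near_cst; near=> n.
  rewrite /F indicE mem_set ?mulr1 ?subrr ?normr0//=.
  by near: n; apply: nbhs_infty_ger; exact: num_real.
- exact: L1_abs.
- by apply/aeW => x n _; rewrite lee_fin normr_id FE.
rewrite integral0 in cv.
have /fine_cvgP[_ /cvgrPdist_lt/(_ e e0)[n _ /(_ n (leqnn n))]] := cv.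
move=> H; exists n; apply: le_lt_trans H; rewrite /= sub0r normrN.
exact: ler_norm.
Unshelve. all: by end_near. Qed.

(* [E <= min E |V| + max 0 (V - W) + (W - V)]: the first two terms are dominated
   by [2 |V|] and the last one has integral zero. *)
Lemma pratt (E W : nat -> X -> R) V :
  (forall n, L1 m (E n)) -> (forall n, L1 m (W n)) -> L1 m V ->
  (forall n x, 0 <= E n x <= W n x) ->
  (forall n, \int[m]_x W n x = \int[m]_x V x) ->
  {ae m, forall x, (fun n => E n x) @ \oo --> 0} ->
  {ae m, forall x, (fun n => W n x) @ \oo --> V x} ->
  (fun n => (\int[m]_x (E n x)%:E)%E) @ \oo --> 0%E.
Proof.
move=> LE LW LV EW IW E0 WV.
pose F n x := Num.min (E n x) `|V x| + Num.max 0 (V x - W n x).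
have LF n : L1 m (F n).
  apply: L1D; last by apply: (L1_max0 (L1B LV (LW n))).
  apply: (L1_le _ _ (L1_abs LV)).
    apply: measurable_minr; first exact: (L1_measurable (LE n)).
    exact: (L1_measurable (L1_abs LV)).
  move=> x; have /andP[E0' _] := EW n x.
  by rewrite ger0_norm ?ge_min ?lexx ?orbT// le_min E0' normr_ge0.
have EF n : \int[m]_x E n x <= \int[m]_x F n x.
  have LD : L1 m (fun x => F n x + (W n x - V x)) by apply: L1D => //; exact: L1B.
  apply: (@le_trans _ _ (\int[m]_x (F n x + (W n x - V x)))).
    apply: int_le => // x _; have /andP[E0' EWx] := EW n x; rewrite /F.
    have := ler_norm (V x).
    case: (lerP (E n x) `|V x|) => ?; case: (lerP 0 (V x - W n x)) => ? ?; lra.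
  rewrite intD//; last exact: L1B.
  by rewrite intB// IW subrr addr0.
have [|||||_ _] := @dominated_convergence _ _ _ m setT measurableT
  (fun n x => (F n x)%:E) (cst 0%E) (fun x => (2 * `|V x|)%:E).
- by move=> n; apply/measurable_EFinP/L1_measurable.
- exact: measurable_cst.
- apply: filterS2 E0 WV => x E0 WV _; apply: cvg_EFin; first exact: nearW.
  apply: (@squeeze_cvgr _ _ _ _ (fun=> 0) (fun n => E n x + `|V x - W n x|)).
  - apply: nearW => n; have /andP[? ?] := EW n x.
    rewrite /F addr_ge0 ?le_max ?lexx// ?le_min; last exact/andP.
    rewrite lerD// ?ge_min ?lexx// ge_max normr_ge0/=; exact: ler_norm.
  - exact: cvg_cst.
  rewrite -[X in _ --> X]addr0; apply: cvgD => //.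
  rewrite -[X in _ --> X](normr0 R) -(subrr (V x)); apply: cvg_norm.
  by apply: cvgB => //; exact: cvg_cst.
- by apply: L1Z; exact: L1_abs.
- apply/aeW => x n _; rewrite lee_fin /F; have /andP[? ?] := EW n x.
  have := ler_norm (V x); have := normr_ge0 (V x) => ? ?.
  rewrite ger0_norm; last by rewrite addr_ge0// ?le_max ?lexx// le_min; apply/andP.
  by case: (lerP (E n x) `|V x|) => ?; case: (lerP 0 (V x - W n x)) => ?; lra.
rewrite integral0 => F0.
apply: (@squeeze_cvge _ _ _ _ (cst 0%E) _ (fun n => (\int[m]_x (F n x)%:E)%E)) => //.
  apply: nearW => n; rewrite integral_ge0/= => [|x _].
    by rewrite -!(EFin_int measurableT)// lee_fin.
  by rewrite lee_fin; have /andP[] := EW n x.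
exact: cvg_cst.
Qed.

Lemma int_triangle f g B : measurable B -> L1 m f -> L1 m g ->
  \int[m]_(x in B) `|f x + g x| <=
  \int[m]_(x in B) `|f x| + \int[m]_(x in B) `|g x|.
Proof.
move=> mB Lf Lg; have La := L1_abs Lf; have Lb := L1_abs Lg.
rewrite -intD//; apply: int_le => //; first exact: L1_abs (L1D Lf Lg).
- exact: L1D.
- by move=> x _; exact: ler_normD.
Qed.

Section ConditionalExpectation.
Variable inv : set X -> Prop.
Hypothesis inv_measurable : forall B, inv B -> measurable B.
Hypothesis inv_sigma : sigma_algebra setT inv.

(** The sets where [g] is nonnegative and where it is negative are invariant, and on each of them
    the integral of [g] equals that of [f]. *)
Lemma cond_exp_contraction f g : L1 m f -> L1 m g ->
  (forall B : set R, measurable B -> inv (g @^-1` B)) ->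
  (forall B, inv B -> \int[m]_(x in B) g x = \int[m]_(x in B) f x) ->
  \int[m]_x `|g x| <= \int[m]_x `|f x|.
Proof.
move=> Lf Lg ginv gf.
pose B := g @^-1` `[0, +oo[%classic; pose C := g @^-1` `]-oo, 0[%classic.
have iB : inv B by exact: ginv. have iC : inv C by exact: ginv.
have mB := inv_measurable iB; have mC := inv_measurable iC.
have BC : setT = B `|` C.
  apply/seteqP; split=> // x _; rewrite /B /C /= !in_itv /= andbT.
  by have [?|?] := lerP 0 (g x); [left|right].
have dBC : [disjoint B & C].
  apply/disj_set2P/seteqP; split=> // x [].
  by rewrite /B /C /= !in_itv /= andbT leNgt => /negP.
have split k : L1 m k -> \int[m]_x k x = \int[m]_(x in B) k x + \int[m]_(x in C) k x.
  by move=> Lk; rewrite BC Rintegral_setU// -BC.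
rewrite (split _ (L1_abs Lf)) (split _ (L1_abs Lg)) lerD//.
  apply: (@le_trans _ _ (\int[m]_(x in B) g x)).
    apply: int_le => //; first exact: L1_abs.
    by move=> x; rewrite /B /= in_itv /= andbT => /ger0_norm->.
  by rewrite gf//; apply: int_le => //; [exact: L1_abs|move=> x _; exact: ler_norm].
apply: (@le_trans _ _ (\int[m]_(x in C) (-1 * g x))).
  apply: int_le => //; [exact: L1_abs|exact: L1Z|].
  by move=> x; rewrite /C /= in_itv /= => /ltr0_norm->; rewrite mulN1r.
rewrite intZ// gf// -intZ//; apply: int_le => //; [exact: L1Z|exact: L1_abs|].
by move=> x _; rewrite mulN1r -normrN ler_norm.
Qed.
End ConditionalExpectation.
End Analysis.

(** * Approximation of centered functions by bounded coboundaries *)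

Section SymmetricCoboundary.
Variables (R : realType) (d : measure_display) (X : measurableType d).
Variable m : probability X R.
Variables (L : finType) (T : L -> X -> X) (iv : L -> L).
Hypothesis L_gt0 : (0 < #|L|)%N.
Hypothesis TK : forall l x, T (iv l) (T l x) = x.
Hypothesis T_measurable : forall l, measurable_fun setT (T l).
Hypothesis T_mp : forall l B, measurable B -> m (T l @^-1` B) = m B.
Implicit Types (f g h u : X -> R).

Lemma Tinv_sigma : sigma_algebra setT (Tinv T).
Proof.
split.
- by split=> // l; rewrite preimage_set0.
- move=> B [mB iB]; split; first exact: measurableD.
  by move=> l; rewrite -[LHS]/(setT `\` (T l @^-1` B)) iB.
move=> B iB; split; first by apply: bigcupT_measurable => i; have [] := iB i.
by move=> l; rewrite preimage_bigcup; apply: eq_bigcupr => i _; have [_ ->] := iB i.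
Qed.

Lemma TinvI B C : Tinv T B -> Tinv T C -> Tinv T (B `&` C).
Proof.
move=> [mB iB] [mC iC]; split; first exact: measurableI.
by move=> l; rewrite preimage_setI iB iC.
Qed.

Lemma near_coboundary_bounded h K e : measurable_fun setT h ->
  (forall x, `|h x| <= K) -> (forall B, Tinv T B -> \int[m]_(x in B) h x = 0) ->
  0 < e -> exists (phi : X -> R) (M : R), [/\ measurable_fun setT phi, forall x, `|phi x| <= M &
    \int[m]_x `|h x - (phi x - Tavg T phi x)| < e].
Proof.
move=> mh hK h0 e0.
have PT := Tavg_markov L_gt0 T_measurable T_mp.
have [n an] := cesaro_L1 L_gt0 TK T_measurable T_mp mh hK h0 e0.
pose phi y := n.+1%:R^-1 * \sum_(k < n.+1) osum (Tavg T) h k y.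
exists phi, (n.+1%:R^-1 * \sum_(k < n.+1) k%:R * K); split.
- apply: measurable_funM => //; apply: measurable_sum => k.
  exact: (osum_measurable PT).
- move=> x; rewrite /phi normrM ger0_norm ?invr_ge0// ler_wpM2l ?invr_ge0//.
  apply: (le_trans (ler_norm_sum _ _ _)); apply: ler_sum => k _.
  exact: (osum_bound PT).
apply: le_lt_trans an; rewrite le_eqVlt; apply/orP; left; apply/eqP.
apply: eq_Rintegral => x _; congr `| _ |.
by rewrite {1}(coboundary PT h x (ltn0Sn n)) addrC addKr.
Qed.

(** Truncating [h] to [h1] spoils the zero integrals, so the conditional expectation [g1] of [h1] is
    subtracted; as [g1] may be unbounded, the difference is cut off on the invariant set [S2], which
    keeps the integrals zero. Each of the four errors is below [e / 4]. *)
Lemma near_coboundary_centered h e : L1 m h ->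
  (forall B, Tinv T B -> \int[m]_(x in B) h x = 0) ->
  0 < e -> exists (phi : X -> R) (M : R), [/\ measurable_fun setT phi, forall x, `|phi x| <= M &
    \int[m]_x `|h x - (phi x - Tavg T phi x)| < e].
Proof.
move=> Lh h0 e0; have e4 : 0 < e / 4 by rewrite divr_gt0.
have iM := @Tinv_measurable _ _ _ T.
have mh := L1_measurable Lh.
have [K1 tail1] := L1_tail Lh mh e4.
set S1 := [set x | `|h x| <= K1%:R] in tail1.
pose h1 x := h x * \1_S1 x.
have level (w : X -> R) (K : nat) :
    [set x | `|w x| <= K%:R] = w @^-1` `[- K%:R, K%:R]%classic.
  by apply/seteqP; split=> x /=; rewrite in_itv /= ler_norml.
have mS1 : measurable S1 by rewrite /S1 level -[_ @^-1` _]setTI; exact: mh.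
have Lh1 : L1 m h1 by exact: L1_indic.
have h1K x : `|h1 x| <= K1%:R.
  by rewrite /h1 indicE; case: (boolP (x \in S1)) => [/[1!inE]|]; rewrite ?mulr1// mulr0 normr0.
have [g1 [g1inv Lg1 g1E]] := cond_exp_exists iM Tinv_sigma Lh1.
(* As [h] integrates to zero over invariant sets, [g1] is also the conditional expectation of
   [h1 - h]. *)
have g1small : \int[m]_x `|g1 x| < e / 4.
  apply: le_lt_trans tail1.
  have := cond_exp_contraction iM (L1B Lh1 Lh) Lg1 g1inv.
  rewrite (@eq_Rintegral _ _ _ _ _ (fun x => `|h x - h1 x|) (fun x => `|h1 x - h x|)); last first.
    by move=> x _; rewrite distrC.
  apply=> B iB; rewrite g1E// intB ?h0 ?subr0//; exact: iM.
have Lk := L1B Lh1 Lg1.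
have [K2 tail2] := L1_tail Lk (L1_measurable Lg1) e4.
set S2 := [set x | `|g1 x| <= K2%:R] in tail2.
have iS2 : Tinv T S2 by rewrite /S2 level; exact: g1inv.
have mS2 := iM _ iS2.
pose h2 x := (h1 x - g1 x) * \1_S2 x.
have Lh2 : L1 m h2 by exact: L1_indic.
have h2K x : `|h2 x| <= K1%:R + K2%:R.
  rewrite /h2 indicE; case: (boolP (x \in S2)) => [/[1!inE] g1x|_].
    by rewrite mulr1 (le_trans (ler_normB _ _))// lerD.
  by rewrite mulr0 normr0 addr_ge0.
have h20 B : Tinv T B -> \int[m]_(x in B) h2 x = 0.
  move=> iB; have iBS := TinvI iB iS2.
  transitivity (\int[m]_(x in B `&` S2) (h1 x - g1 x)).
    rewrite int_indic [RHS]int_indic; apply: eq_Rintegral => x _.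
    by rewrite indicI /= -mulrA [\1_S2 x * _]mulrC.
  by rewrite (intB (iM _ iBS) Lh1 Lg1) g1E// subrr.
have [phi [M [mphi phiM phismall]]] :=
  near_coboundary_bounded (L1_measurable Lh2) h2K h20 e4.
exists phi, M; split => //.
have Lphi := L1_bounded m mphi phiM.
have PT := Tavg_markov L_gt0 T_measurable T_mp.
have Lc := L1B Lphi (mk_L1 PT Lphi).
have La := L1B Lh Lh1; have Lb := L1B Lk Lh2; have Ld := L1B Lh2 Lc.
apply: (@le_lt_trans _ _ (\int[m]_x `|((h x - h1 x) + g1 x) +
    ((h1 x - g1 x - h2 x) + (h2 x - (phi x - Tavg T phi x)))|)).
  rewrite le_eqVlt; apply/orP; left; apply/eqP; apply: eq_Rintegral => x _.
  by congr `| _ |; ring.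
apply: (le_lt_trans (int_triangle measurableT (L1D La Lg1) (L1D Lb Ld))).
have T1 := int_triangle measurableT La Lg1.
have T2 := int_triangle measurableT Lb Ld.
apply: (le_lt_trans (lerD T1 T2)).
have -> : e = (e / 4 + e / 4) + (e / 4 + e / 4) by field.
by rewrite !ltrD.
Qed.
End SymmetricCoboundary.

(** * Limits identified as conditional expectations, and convergence in the mean *)

Section MeanConvergence.
Variables (R : realType) (d : measure_display) (X : measurableType d).
Variable m : probability X R.
Variable inv : set X -> Prop.
Hypothesis inv_measurable : forall B, inv B -> measurable B.
Hypothesis inv_sigma : sigma_algebra setT inv.
Variable A : nat -> (X -> R) -> X -> R.
Hypothesis mA : forall n, markov_op m inv (A n).
Hypothesis A_cvg0 : forall h, L1 m h -> (forall B, inv B -> \int[m]_(x in B) h x = 0) ->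
  {ae m, forall x, (fun n => A n h x) @ \oo --> 0}.
Implicit Types f g : X -> R.

Definition cond_exp f g := [/\ forall B : set R, measurable B -> inv (g @^-1` B),
  L1 m g & forall B, inv B -> \int[m]_(x in B) g x = \int[m]_(x in B) f x].

(** The level set of [g] through [x] is invariant, and on it [g] is a constant. *)
Lemma markov_fix n g x : (forall B : set R, measurable B -> inv (g @^-1` B)) ->
  A n g x = g x.
Proof.
move=> ginv; rewrite (mk_local (mA n) (ginv [set g x] (measurable_set1 _))
  (f := g) (g := fun=> g x))//; exact: (mk_cst (mA n)).
Qed.

Lemma mean_cvg f g : L1 m f -> cond_exp f g ->
  {ae m, forall x, (fun n => A n f x) @ \oo --> g x}.
Proof.
move=> Lf [ginv Lg gE].
have h0 B : inv B -> \int[m]_(x in B) (f x - g x) = 0.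
  by move=> iB; rewrite (intB (inv_measurable iB) Lf Lg) gE// subrr.
apply: filterS (A_cvg0 (L1B Lf Lg) h0) => x hx.
have -> : (fun n => A n f x) = (fun n => A n (fun y => f y - g y) x + g x).
  by apply/funext => n; rewrite (mkB (mA n)) (markov_fix _ _ ginv) subrK.
by rewrite -[X in _ --> X]add0r; apply: cvgD => //; exact: cvg_cst.
Qed.

Let invT : inv setT.
Proof. by have [i0 iC _] := inv_sigma; rewrite -(setD0 setT); exact: iC. Qed.

Lemma mean_Lp_cvg f g p : 1 <= p -> measurable_fun setT f ->
  L1 m (fun x => `|f x| `^ p) -> L1 m f -> cond_exp f g ->
  (fun n => (\int[m]_x (`|A n f x - g x| `^ p)%:E)%E) @ \oo --> 0%E.
Proof.
move=> p1 mf LF Lf gce; have p0 : 0 < p by lra.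
have [ginv Lg gE] := gce; have mg := L1_measurable Lg.
pose F x := `|f x| `^ p.
have [G Gce] := cond_exp_exists inv_measurable inv_sigma LF.
have fg := mean_cvg Lf gce; have FG := mean_cvg LF Gce.
have [Ginv LG GE] := Gce.
(* The conditional Jensen inequality, by passing to the limit in the tangent inequality at [|g x|];
   it makes [|g| ^ p] integrable. *)
have gG : {ae m, forall x, `|g x| `^ p <= G x}.
  apply: filterS2 fg FG => x fgx FGx.
  have tang n : `|g x| `^ p + p * `|g x| `^ (p - 1) * (`|A n f x| - `|g x|) <= A n F x.
    by apply: le_trans (jensen f x (mA n) p1); exact: powR_tangent.
  have tcvg : (fun n => `|g x| `^ p + p * `|g x| `^ (p - 1) * (`|A n f x| - `|g x|))
      @ \oo --> `|g x| `^ p.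
    rewrite -[X in _ --> X]addr0; apply: cvgD; first exact: cvg_cst.
    rewrite -[X in _ --> X](mulr0 (p * `|g x| `^ (p - 1))); apply: cvgM; first exact: cvg_cst.
    by rewrite -(subrr `|g x|); apply: cvgB; [exact: cvg_norm|exact: cvg_cst].
  by apply: (ler_cvg_to tcvg FGx); exact: nearW.
have Lgp : L1 m (fun x => `|g x| `^ p).
  have mgp := measurable_norm_powR p mg.
  apply/integrableP; split; first exact/measurable_EFinP.
  have /integrableP[_] := LG; apply: le_lt_trans.
  apply: ae_ge0_le_integral => //.
  - by do 2 apply: measurableT_comp => //.
  - by do 2 apply: measurableT_comp => //; exact: L1_measurable LG.
  apply: filterS gG => x gGx _ /=; rewrite lee_fin ger0_norm ?powR_ge0//.
  exact: le_trans (ler_norm _).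
have c0 : 0 <= 2 `^ p :> R := powR_ge0 _ _.
apply: (@pratt _ _ _ m (fun n x => `|A n f x - g x| `^ p)
  (fun n x => 2 `^ p * (A n F x + `|g x| `^ p)) (fun x => 2 `^ p * (G x + `|g x| `^ p))).
- move=> n; have LAF := L1D (mk_L1 (mA n) LF) Lgp.
  apply: (L1_le _ _ (L1Z (2 `^ p) LAF)).
    apply: measurable_norm_powR; apply: measurable_funB => //.
    exact: (mk_measurable (mA n)).
  move=> x; rewrite ger0_norm ?powR_ge0// (le_trans (powR_normB_le _ _ p1))//.
  by rewrite ler_wpM2l// lerD2r; exact: (jensen f x (mA n) p1).
- by move=> n; apply: L1Z; apply: L1D => //; exact: (mk_L1 (mA n)).
- by apply: L1Z; exact: L1D.
- move=> n x; rewrite powR_ge0 (le_trans (powR_normB_le _ _ p1))//.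
  by rewrite ler_wpM2l// lerD2r; exact: (jensen f x (mA n) p1).
- move=> n; have LAF := mk_L1 (mA n) LF.
  rewrite !intZ//; try exact: L1D.
  by rewrite !intD// (mk_int (mA n) invT LF) GE.
- apply: filterS fg => x fgx; apply/cvgrPdist_lt => e e0.
  have e1 : 0 < e `^ p^-1 by exact: powR_gt0.
  have := fgx => /cvgrPdist_lt/(_ _ e1); apply: filterS => n.
  rewrite sub0r normrN (ger0_norm (powR_ge0 _ _)) distrC => small.
  have -> : e = (e `^ p^-1) `^ p by rewrite -powRrM mulVf ?gt_eqF// powRr1// ltW.
  by rewrite gt0_ltr_powR ?nnegrE ?powR_ge0.
apply: filterS FG => x FGx.
by apply: cvgM; [exact: cvg_cst|apply: cvgD => //; exact: cvg_cst].
Qed.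
End MeanConvergence.

(** * Actions of the free group *)

Section FreeGroup.
Variables (r : nat) (R : realType) (d : measure_display) (X : measurableType d).
Variables (m : probability X R) (act : FG r -> X -> X).
Hypothesis r2 : (2 <= r)%N.
Hypothesis act_mp : mp_action m act.
Implicit Types f g : X -> R.

Let act1 x : act (fg_one r) x = x. Proof. by case: act_mp. Qed.
Let actM u v x : act (fg_mul u v) x = act u (act v x). Proof. by case: act_mp. Qed.
Let act_meas w : measurable_fun setT (act w). Proof. by case: act_mp. Qed.
Let act_pres w A : measurable A -> m (act w @^-1` A) = m A.
Proof. by case: act_mp => _ _ _; exact. Qed.
Let r0 : (0 < r)%N. Proof. exact: ltnW. Qed.

Local Notation T := (gen act).

Let letter_gt0 : (0 < #|{: letter r}|)%N.
Proof. by rewrite card_prod card_ord card_bool; lia. Qed.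

Lemma Tinv_act B : Tinv T B -> forall w, act w @^-1` B = B.
Proof.
move=> [_ iB] w; rewrite -(word_sval w).
rewrite (_ : act _ = foldr T ^~ (sval w)); last first.
  by apply/funext => x; exact: act_word.
elim: (sval w) => [|l s IH] //.
by rewrite -[LHS]/((foldr T ^~ s) @^-1` (T l @^-1` B)) iB.
Qed.

Lemma Tinv_invariant B : Tinv T B <-> invariant_set act B.
Proof.
split=> [iB|[mB iB]]; last by split=> // l; exact: iB.
by split; [case: iB|exact: Tinv_act].
Qed.

Let inv_meas B : invariant_set act B -> measurable B. Proof. by case. Qed.

Let inv_eq : Tinv T = invariant_set act.
Proof. by apply/funext => B; apply/propext; exact: Tinv_invariant. Qed.

Lemma invariant_sigma : sigma_algebra setT (invariant_set act).
Proof. by rewrite -inv_eq; exact: Tinv_sigma. Qed.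

Let invT : invariant_set act setT. Proof. by split. Qed.

Lemma pi_sigma_markov k :
  markov_op m (invariant_set act) (fun f => @pi_sigma r R X act k f).
Proof.
have sz : (0 < size (sphere r k))%N.
  (* The sphere is counted through [rsum], which requires some base point. *)
  have [x _] : exists x : X, True by exists point.
  have := rsum_count_gt0 act1 actM R r0 x k.
  rewrite /rsum -(@sum_sphere r R k (fun=> 1)) big_const_seq count_predT iter_addr addr0.
  by rewrite ltr0n.
apply: (@markov_mean _ _ _ m _ inv_meas _ (sphere r k) (fun w f x => f (act (fg_inv w) x))) => // w.
apply: (markov_comp inv_meas) => // [B mB|B [_]]; [exact: act_pres|exact].
Qed.

Let q : R := (2 * r).-1%:R.

(** Equivalently, the radial walk steps down with probability at most [1 / 4]. *)
Let q3 : 3 <= q. Proof. by rewrite (ler_nat R 3) ; lia. Qed.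

Let s (k : nat) f : X -> R := pi_sigma act k f.

Let s_rec f k x : (q + 1) * s 1 (s k.+1 f) x = q * s k.+2 f x + s k f x.
Proof.
rewrite -(pi_sigma_rec act1 actM r0) natr1; congr (_%:R * _); lia.
Qed.

Let s0 f x : s 0 f x = f x. Proof. exact: pi_sigma0. Qed.

Let TavgE : Tavg T = s 1 :> ((X -> R) -> X -> R).
Proof. by apply/funext => f; apply/funext => x; rewrite /s pi_sigma1. Qed.

Lemma pi_mu_maximal f a : L1 m f -> 0 < a ->
  (m (\bigcup_n [set x | (a < `|pi_mu act n f x|)%R]) <=
    (12 / a * \int[m]_x `|f x|)%R%:E)%E.
Proof. by move=> Lf a0; exact: (smean_maximal inv_meas invT q3 pi_sigma_markov s0 s_rec Lf a0). Qed.

Lemma pi_mu_markov n : markov_op m (invariant_set act) (fun f => @pi_mu r R X act n f).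
Proof. exact: (smean_markov inv_meas pi_sigma_markov). Qed.

Lemma pi_mu_cvg0 h : L1 m h ->
  (forall B, invariant_set act B -> \int[m]_(x in B) h x = 0) ->
  {ae m, forall x, (fun n => pi_mu act n h x) @ \oo --> 0}.
Proof.
move=> Lh h0; apply: (smean_cvg0 inv_meas invT q3 pi_sigma_markov s0 s_rec Lh) => e e0.
rewrite -inv_eq in h0; rewrite -[pi_sigma act 1]/(s 1) -TavgE.
exact: (near_coboundary_centered letter_gt0 (genK act1 actM) (fun l => act_meas _)
  (fun l B => @act_pres _ B) Lh h0 e0).
Qed.

Lemma cond_exp_invP f g : L1 m f ->
  cond_exp_inv m act f g <-> cond_exp m (invariant_set act) f g.
Proof.
move=> Lf; split=> -[gB Lg gE]; split=> // B iB.
  by rewrite /Rintegral gE.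
by rewrite -!EFin_int ?gE//; exact: inv_meas.
Qed.
End FreeGroup.

Unset Implicit Arguments.

Theorem theorem13p1 (r : nat) (hr : (2 <= r)%N) (R : realType) :
  (* (a) weak type (1,1) maximal inequality, C independent of the action *)
  (exists C : R,
    forall (d : measure_display) (X : measurableType d) (m : probability X R)
           (act : FG r -> X -> X),
      mp_action m act ->
      forall (f : X -> R) (delta : R),
        measurable_fun setT f -> m.-integrable setT (EFin \o f) -> 0 < delta ->
        (m [set x | (delta%:E <
                      ereal_sup (range (fun n => (`|pi_mu act n f x|)%:E)))%E]
         <= (C / delta)%:E * \int[m]_x (`|f x|)%:E)%E)
  /\
  (* (b) pointwise and L^p convergence to the conditional expectation *)
  (forall (d : measure_display) (X : measurableType d) (m : probability X R)
          (act : FG r -> X -> X),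
     mp_action m act ->
     forall (p : R) (f : X -> R),
       1 <= p -> measurable_fun setT f ->
       m.-integrable setT (fun x => (`|f x| `^ p)%:E) ->
       (exists g, cond_exp_inv m act f g) /\
       (forall g, cond_exp_inv m act f g ->
          {ae m, forall x, (fun n => pi_mu act n f x) @ \oo --> g x} /\
          (fun n => (\int[m]_x (`|pi_mu act n f x - g x| `^ p)%:E)%E) @ \oo
            --> 0%E)).
Proof.
split.
  exists 12 => d X m act act_mp f a mf Lf a0.
  have := pi_mu_maximal hr act_mp Lf a0.
  rewrite EFinM (EFin_int measurableT (L1_abs Lf)); apply: le_trans.
  (* The supremum exceeds [a] exactly when one of its terms does. *)
  rewrite le_eqVlt; apply/orP; left; apply/eqP; congr (m _).
  apply/seteqP; split=> x /=.
    by move=> /ereal_sup_gt[_ [n _ <-]]; rewrite lte_fin => an; exists n.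
  move=> [n _ /= an]; apply: (@lt_le_trans _ _ (`|pi_mu act n f x|)%:E).
    by rewrite lte_fin.
  by apply: ereal_sup_ubound; exists n.
move=> d X m act act_mp p f p1 mf LF.
(* On a probability space [|f| <= 1 + |f| ^ p] gives integrability of [f]. *)
have Lf : L1 m f.
  apply: (L1_le mf _ (L1D (L1cst m 1) LF)) => x.
  have [f1|f1] := lerP `|f x| 1; first by rewrite (le_trans f1)// lerDl powR_ge0.
  rewrite -[leLHS]powRr1// (le_trans (ler_powR (ltW f1) p1))//.
  by rewrite lerDr.
have mA := pi_mu_markov hr act_mp.
have A0 := @pi_mu_cvg0 _ _ _ _ _ _ hr act_mp.
have iM B : invariant_set act B -> measurable B by case.
have sI : sigma_algebra setT (invariant_set act).
  exact: invariant_sigma act_mp.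
split.
  have [g gce] := cond_exp_exists iM sI Lf.
  by exists g; apply/cond_exp_invP.
move=> g /(cond_exp_invP act g Lf) gce; split.
  exact: (mean_cvg iM mA A0 Lf gce).
exact: (mean_Lp_cvg iM sI mA A0 p1 mf LF Lf gce).
Qed.
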